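(* Let $T:\mathcal B\to\mathcal B$, $T(x,y,z)=(2xz-y,\ z,\ 4xz^2-2yz-x)$. The restriction of $T$ to $\partial\mathcal B$ is the pillowcase quotient of the classical cat map $$A=\begin{pmatrix}2&1\\1&1\end{pmatrix}:\mathbb T^2\to\mathbb T^2,$$ that is, under the identification of $\partial\mathcal B$ with the pillowcase $\mathbb T^2/\{\xi\sim-\xi\}$, $T|_{\partial\mathcal B}$ is the map induced by $A$. It has topological entropy $\log\left(\frac{3+\sqrt5}{2}\right)$ and dense periodic points. In the orbifold sense it is pseudo-Anosov: its stable and unstable measured foliations are the quotients of the linear foliations of $\mathbb T^2$ by the eigendirections of $A$.
   Context: $\mathbb T^2=(\mathbb R/2\pi\mathbb Z)^2$. $\mathcal B=\{(x,y,z)\in[-1,1]^3:x^2+y^2+z^2-2xyz\le1\}$; the trace coordinates $x=\tfrac12\operatorname{tr}(q_1)$, $y=\tfrac12\operatorname{tr}(q_2)$, $z=\tfrac12\operatorname{tr}(q_1q_2)$ identify $\mathrm{SU}(2)^2/\mathrm{SU}(2)$ (quotient by simultaneous conjugation) with $\mathcal B$, and $T$ is the map induced by $F(q_1,q_2)=(q_1^2q_2,q_1q_2)$. The boundary is $\partial\mathcal B=\{(x,y,z)\in\mathcal B:1-x^2-y^2-z^2+2xyz=0\}$ and consists exactly of the classes of commuting pairs. The pillowcase is $\mathbb T^2/\{\xi\sim-\xi\}$, a topological two-sphere with four orbifold points, the images of the four fixed points of $\xi\mapsto-\xi$. It is identified with $\partial\mathcal B$ by sending $[\theta,\varphi]$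 to the class of the commuting pair $(e^{I\theta},e^{I\varphi})$, $I$ any unit imaginary quaternion, i.e. to $(\cos\theta,\cos\varphi,\cos(\theta+\varphi))$. Since $A$ commutes with $\xi\mapsto-\xi$, it induces a map of the pillowcase. ''Pseudo-Anosov in the orbifold sense'' means: away from the four orbifold points there are two transverse measured foliations, invariant under the map, whose transverse measures are multiplied by $\lambda$ and $\lambda^{-1}$ respectively for some $\lambda>1$. *)

(* Defs.v *)
From HB Require Import structures.
From mathcomp Require Import all_boot all_order all_algebra.
From mathcomp Require Import all_classical all_reals all_analysis.
From mathcomp Require Import generic_quotient ring lra.
Import numFieldNormedType.Exports.
Import Order.TTheory GRing.Theory Num.Theory.

Set Implicit Arguments.
Unset Strict Implicit.
Unset Printing Implicit Defensive.

Local Open Scope classical_set_scope.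
Local Open Scope quotient_scope.
Local Open Scope ring_scope.

Definition homeomorphism (X Y : topologicalType) (f : X -> Y) : Prop :=
  continuous f /\
  exists g : Y -> X, [/\ continuous g, cancel f g & cancel g f].

(* Bowen's definition, for a continuous self-map of a compact space.  The
   separated sets grow when [e] shrinks, so the supremum over [e] in
   [topological_entropy] is the limit as [e] tends to 0. *)
Section Entropy.
Context {R : realType} {X : pseudoMetricType R}.
Implicit Types (f : X -> X) (n : nat) (e : R).

Definition separated f n e (s : seq X) : Prop :=
  uniq s /\ forall x y, x \in s -> y \in s -> x <> y ->
    exists2 k, (k < n)%N & ~ ball (iter k f x) e (iter k f y).

Definition separated_growth f e : \bar R :=
  limn_esup (fun n =>
    ereal_sup [set (ln (size s)%:R / n%:R)%:E | s in separated f n e]).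

Definition topological_entropy f : \bar R :=
  ereal_sup [set separated_growth f e | e in [set e | 0 < e]].

End Entropy.

Definition periodic_points {X : Type} (f : X -> X) : set X :=
  [set p | exists2 n, (0 < n)%N & iter n f p = p].

(* A measured foliation of the surface [S] is given by an atlas whose
   transition maps have the form (x, y) |-> (h (x, y), c +- y).  The leaves are
   locally the curves y = constant, and the transverse measure is |dy|. *)
Section MeasuredFoliations.
Context {R : realType}.

(* a domain together with a coordinate map, meaningful on that domain only *)
Definition chart (X : Type) : Type := (set X * (X -> R * R))%type.

Definition transverse_coord {X : Type} (c : chart X) (q : X) : R := (c.2 q).2.

Definition is_chart {X : topologicalType} (c : chart X) : Prop :=
  [/\ open c.1,
      forall p, c.1 p -> {for p, continuous c.2},
      forall p q, c.1 p -> c.1 q -> c.2 p = c.2 q -> p = q &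
      forall V, open V -> V `<=` c.1 -> open (c.2 @` V)].

(* v = +- k u + b near p *)
Definition affine_near {X : topologicalType} (k : R) (u v : X -> R) (p : X) :=
  exists (s : bool) (b : R), \forall q \near p, v q = (-1) ^+ s * k * u q + b.

Definition measured_foliation {X : topologicalType}
    (S : set X) (F : set (chart X)) : Prop :=
  [/\ forall c, F c -> is_chart c /\ c.1 `<=` S,
      forall p, S p -> exists2 c, F c & c.1 p &
      forall c d p, F c -> F d -> c.1 p -> d.1 p ->
        affine_near 1 (transverse_coord c) (transverse_coord d) p].

(* the leaves of [F] and of [G] are the coordinate lines of common charts *)
Definition transverse {X : topologicalType} (F G : set (chart X)) : Prop :=
  forall c d p, F c -> G d -> c.1 p -> d.1 p ->
    exists2 U : set X, U p &
      is_chart (U, fun q => (transverse_coord c q, transverse_coord d q)).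

(* [f] maps leaves into leaves, and the transverse measure of [f \o g] is [k]
   times that of [g], for every arc [g] *)
Definition multiplies_measure {X : topologicalType} (f : X -> X) (k : R)
    (F : set (chart X)) : Prop :=
  forall c d p, F c -> F d -> c.1 p -> d.1 (f p) ->
    affine_near k (transverse_coord c) (transverse_coord d \o f) p.

(* [f] is pseudo-Anosov away from the set [P] of orbifold points, with stable
   foliation [Fs], unstable foliation [Fu] and stretch factor [k].  The leaves
   of [Fs] are contracted, so the measure transverse to them is multiplied by
   [k]; symmetrically for [Fu]. *)
Definition orbifold_pseudo_Anosov {X : topologicalType} (P : set X)
    (f : X -> X) (k : R) (Fs Fu : set (chart X)) : Prop :=
  [/\ homeomorphism f /\ f @` P = P,
      1 < k,
      measured_foliation (~` P) Fs /\ measured_foliation (~` P) Fu,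
      transverse Fs Fu &
      multiplies_measure f k Fs /\ multiplies_measure f k^-1 Fu].

(* the charts in [S] that are compatible with [F] through the projection [h] *)
Definition quotient_foliation {X Y : topologicalType} (h : X -> Y) (S : set Y)
    (F : set (chart X)) : set (chart Y) :=
  [set d | [/\ is_chart d, d.1 `<=` S &
    forall c p, F c -> c.1 p -> d.1 (h p) ->
      affine_near 1 (transverse_coord c) (transverse_coord d \o h) p]].

(* leaves: the lines parallel to [v]; transverse measure: |det (v, d xi)| *)
Definition plane_foliation (v : 'cV[R]_2) : set (chart 'cV[R]_2) :=
  [set c | is_chart c /\ forall p, c.1 p ->
    affine_near 1 (fun xi : 'cV[R]_2 => \det (row_mx v xi : 'M[R]_2))
      (transverse_coord c) p].

End MeasuredFoliations.

Definition cat_matrix : 'M[int]_2 :=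
  \matrix_(i < 2, j < 2) nth 0 (nth [::] [:: [:: 2; 1]; [:: 1; 1]] i) j.

Section Pillowcase.
Context {R : realType}.
Implicit Types xi eta : 'cV[R]_2.

Local Notation pi := (@trigo.pi R).

Definition torus_rel xi eta : bool :=
  `[< exists m : 'cV[int]_2, xi - eta = (2 * pi) *: map_mx intr m >].

Lemma torus_rel_refl : reflexive torus_rel.
Proof.
by move=> xi; apply/asboolP; exists 0; rewrite subrr map_mx0 scaler0.
Qed.

Lemma torus_rel_sym : symmetric torus_rel.
Proof.
suff H xi eta : torus_rel xi eta -> torus_rel eta xi.
  by move=> xi eta; apply/idP/idP; exact: H.
move=> /asboolP[m hm]; apply/asboolP; exists (- m).
by rewrite map_mxN scalerN -hm opprB.
Qed.

Lemma torus_rel_trans : transitive torus_rel.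
Proof.
move=> eta xi zeta /asboolP[m hm] /asboolP[n hn]; apply/asboolP; exists (m + n).
by rewrite map_mxD scalerDr -hm -hn addrA subrK.
Qed.

Canonical torus_equiv :=
  EquivRel torus_rel torus_rel_refl torus_rel_sym torus_rel_trans.

Definition torus : topologicalType := quotient_topology {eq_quot torus_equiv}.

Definition to_torus xi : torus := \pi_{eq_quot torus_equiv} xi.

Lemma to_torus_eq xi eta : to_torus xi = to_torus eta <->
  exists m : 'cV[int]_2, xi - eta = (2 * pi) *: map_mx intr m.
Proof.
split=> [/eqmodP h|h]; first exact/asboolP.
by apply/eqmodP/asboolP.
Qed.

Definition torus_repr (p : torus) : 'cV[R]_2 :=
  repr (p : {eq_quot torus_equiv}).

Lemma torus_reprK p : to_torus (torus_repr p) = p.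
Proof. exact: reprK. Qed.

Definition cat_map xi : 'cV[R]_2 := map_mx intr cat_matrix *m xi.

Definition torus_cat (p : torus) : torus := to_torus (cat_map (torus_repr p)).

Definition torus_opp (p : torus) : torus := to_torus (- torus_repr p).

Lemma torus_catE xi : torus_cat (to_torus xi) = to_torus (cat_map xi).
Proof.
have /to_torus_eq[m hm] := torus_reprK (to_torus xi).
apply/to_torus_eq; exists (cat_matrix *m m).
by rewrite map_mxM scalemxAr -hm mulmxBr.
Qed.

Lemma torus_oppE xi : torus_opp (to_torus xi) = to_torus (- xi).
Proof.
have /to_torus_eq[m hm] := torus_reprK (to_torus xi).
apply/to_torus_eq; exists (- m).
by rewrite map_mxN scalerN -hm opprD.
Qed.

Lemma torus_oppK : involutive torus_opp.
Proof. by move=> p; rewrite -(torus_reprK p) !torus_oppE opprK. Qed.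

Lemma torus_cat_opp p : torus_cat (torus_opp p) = torus_opp (torus_cat p).
Proof.
by rewrite -(torus_reprK p) torus_oppE !torus_catE torus_oppE /cat_map mulmxN.
Qed.

Definition pillow_rel (p q : torus) : bool := (p == q) || (p == torus_opp q).

Lemma pillow_rel_refl : reflexive pillow_rel.
Proof. by move=> p; rewrite /pillow_rel eqxx. Qed.

Lemma pillow_rel_sym : symmetric pillow_rel.
Proof.
move=> p q; rewrite /pillow_rel eq_sym; congr (_ || _).
by apply/eqP/eqP => ->; rewrite torus_oppK.
Qed.

Lemma pillow_rel_trans : transitive pillow_rel.
Proof.
move=> q p r; rewrite /pillow_rel => /orP[/eqP->//|/eqP->].
by case/orP=> /eqP->; rewrite ?torus_oppK eqxx ?orbT.
Qed.

Canonical pillow_equiv :=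
  EquivRel pillow_rel pillow_rel_refl pillow_rel_sym pillow_rel_trans.

Definition pillowcase : topologicalType :=
  quotient_topology {eq_quot pillow_equiv}.

Definition to_pillow (p : torus) : pillowcase := \pi_{eq_quot pillow_equiv} p.

Lemma to_pillow_eq p q :
  to_pillow p = to_pillow q <-> p = q \/ p = torus_opp q.
Proof.
split=> [/eqmodP/orP[]/eqP|h]; [by left|by right|].
by apply/eqmodP/orP; case: h => ->; [left|right].
Qed.

Definition pillow_repr (P : pillowcase) : torus :=
  repr (P : {eq_quot pillow_equiv}).

Lemma pillow_reprK P : to_pillow (pillow_repr P) = P.
Proof. exact: reprK. Qed.

Definition pillow_cat (P : pillowcase) : pillowcase :=
  to_pillow (torus_cat (pillow_repr P)).

Lemma pillow_catE p : pillow_cat (to_pillow p) = to_pillow (torus_cat p).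
Proof.
have /to_pillow_eq[h|h] := pillow_reprK (to_pillow p); apply/to_pillow_eq.
  by left; rewrite h.
by right; rewrite h torus_cat_opp.
Qed.

End Pillowcase.

Arguments torus : clear implicits.
Arguments pillowcase : clear implicits.

Section TraceMap.
Context {R : realType}.
Implicit Types p : R * R * R.

Definition trace_body : set (R * R * R) :=
  [set p | let: (x, y, z) := p in
    [/\ -1 <= x <= 1, -1 <= y <= 1, -1 <= z <= 1 &
        x ^+ 2 + y ^+ 2 + z ^+ 2 - 2 * x * y * z <= 1]].

Definition trace_boundary : set (R * R * R) :=
  [set p | trace_body p /\ let: (x, y, z) := p in
    1 - x ^+ 2 - y ^+ 2 - z ^+ 2 + 2 * x * y * z = 0].

Definition trace_map p : R * R * R :=
  let: (x, y, z) := p in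
  (2 * x * z - y, z, 4 * x * z ^+ 2 - 2 * y * z - x).

Lemma trace_bound (x y z : R) : -1 <= x <= 1 -> -1 <= z <= 1 ->
  x ^+ 2 + y ^+ 2 + z ^+ 2 - 2 * x * y * z <= 1 -> -1 <= y <= 1.
Proof.
move=> /andP[x1 x2] /andP[z1 z2] h.
have hx : 0 <= (1 - x) * (1 + x) by apply: mulr_ge0; lra.
have hz : 0 <= (1 - z) * (1 + z) by apply: mulr_ge0; lra.
apply/andP; split; rewrite leNgt; apply/negP => hy.
- have a : 0 <= 1 + x * z by nra.
  have b : 1 + x * z < x * z - y by lra.
  have : (1 + x * z) ^+ 2 < (x * z - y) ^+ 2 by rewrite ltr_pXn2r // nnegrE; lra.
  have := sqr_ge0 (x + z); nra.
- have a : 0 <= 1 - x * z by nra.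
  have b : 1 - x * z < y - x * z by lra.
  have : (1 - x * z) ^+ 2 < (y - x * z) ^+ 2 by rewrite ltr_pXn2r // nnegrE; lra.
  have := sqr_ge0 (x - z); nra.
Qed.

Lemma trace_map_body p : trace_body p -> trace_body (trace_map p).
Proof.
case: p => [[x y] z] [hx hy hz h] /=.
have hy' : -1 <= 2 * x * z - y <= 1 by apply: (trace_bound hx hz); nra.
by split=> //; [apply: (trace_bound hy' hz)|]; nra.
Qed.

Lemma trace_map_boundary p : trace_boundary p -> trace_boundary (trace_map p).
Proof.
move=> [hp h]; split; first exact: trace_map_body.
by case: p {hp} h => [[x y] z] /= <-; ring.
Qed.

Definition boundary_map (p : trace_boundary) : trace_boundary :=
  SigSub (mem_set (trace_map_boundary (set_valP p))).

(* the trace coordinates of the pair (e^(I theta), e^(I phi)) *)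
Definition commuting_trace (xi : 'cV[R]_2) : R * R * R :=
  let theta := xi 0 0 in let phi := xi 1 0 in
  (cos theta, cos phi, cos (theta + phi)).

Lemma commuting_trace_boundary xi : trace_boundary (commuting_trace xi).
Proof.
rewrite /commuting_trace; move: (xi 0 0) (xi 1 0) => a b.
have cb (c : R) : -1 <= cos c <= 1 by rewrite cos_geN1 cos_le1.
have ha := cos2Dsin2 a; have hb := cos2Dsin2 b.
have E : 1 - cos a ^+ 2 - cos b ^+ 2 - cos (a + b) ^+ 2
         + 2 * cos a * cos b * cos (a + b) = 0.
  rewrite cosD.
  have -> : 1 - cos a ^+ 2 - cos b ^+ 2 -
      (cos a * cos b - sin a * sin b) ^+ 2 +
      2 * cos a * cos b * (cos a * cos b - sin a * sin b)
    = 1 - cos a ^+ 2 - cos b ^+ 2 + cos a ^+ 2 * cos b ^+ 2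
      - sin a ^+ 2 * sin b ^+ 2 by ring.
  have -> : sin a ^+ 2 = 1 - cos a ^+ 2 by rewrite -ha addrAC subrr add0r.
  have -> : sin b ^+ 2 = 1 - cos b ^+ 2 by rewrite -hb addrAC subrr add0r.
  ring.
by split=> //=; split=> //; lra.
Qed.

Definition pillow_to_boundary (P : pillowcase R) : trace_boundary :=
  SigSub (mem_set
    (commuting_trace_boundary (torus_repr (pillow_repr P)))).

Lemma cosD_int2pi (a : R) (k : int) : cos (a + 2 * trigo.pi * k%:~R) = cos a.
Proof.
have P (b : R) (n : nat) : cos (b + 2 * trigo.pi * n%:R) = cos b.
  elim: n => [|n IH]; first by rewrite mulr0 addr0.
  have -> : b + 2 * trigo.pi * n.+1%:R
    = b + 2 * trigo.pi * n%:R + trigo.pi + trigo.pi by rewrite -natr1; ring.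
  by rewrite !cosDpi opprK IH.
case: k => n; first exact: P.
by rewrite -(P (a + _) n.+1) NegzE mulrNz mulrN addrNK.
Qed.

Lemma commuting_trace_torus xi eta :
  to_torus xi = to_torus eta -> commuting_trace xi = commuting_trace eta.
Proof.
move=> /to_torus_eq[m hm].
have E i : xi i 0 = eta i 0 + 2 * trigo.pi * (m i 0)%:~R.
  by have /matrixP/(_ i 0) := hm; rewrite !mxE => <-; ring.
rewrite /commuting_trace !E !cosD_int2pi; congr (_, _, _).
rewrite -(cosD_int2pi (eta 0 0 + eta 1 0) (m 0 0 + m 1 0)) intrD.
by congr cos; ring.
Qed.

Lemma pillow_to_boundaryE xi :
  \val (pillow_to_boundary (to_pillow (to_torus xi))) = commuting_trace xi.
Proof.
rewrite /=; have /to_pillow_eq[h|h] := pillow_reprK (to_pillow (to_torus xi)).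
  by apply: commuting_trace_torus; rewrite torus_reprK h.
have -> : commuting_trace xi = commuting_trace (- xi).
  by rewrite /commuting_trace !mxE -opprD !cosN.
by apply: commuting_trace_torus; rewrite torus_reprK h torus_oppE.
Qed.

Definition torus_to_boundary (p : torus R) : trace_boundary :=
  pillow_to_boundary (to_pillow p).

(* the images of the four fixed points of the involution of the torus *)
Definition orbifold_points : set trace_boundary :=
  torus_to_boundary @` [set p | torus_opp p = p].

Definition is_eigenvector (a : R) (v : 'cV[R]_2) : Prop :=
  v != 0 /\ cat_map v = a *: v.

Definition torus_foliation (v : 'cV[R]_2) : set (chart (R := R) (torus R)) :=
  quotient_foliation to_torus setT (plane_foliation v).

Definition boundary_foliation (v : 'cV[R]_2) :
    set (chart (R := R) trace_boundary) :=
  quotient_foliation torus_to_boundary (~` orbifold_points)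
    (torus_foliation v).

End TraceMap.

Arguments trace_body : clear implicits.
Arguments trace_boundary : clear implicits.

(* Main.v *)
(* The projection xi |-> (cos xi_0, cos xi_1, cos (xi_0 + xi_1)) of the plane is
   the quotient by xi |-> +- xi + 2 pi m, and it semiconjugates the linear map A
   to T; periodic points come from rational points, and the foliations are read
   in the two eigencoordinates of A.

   Entropy, upper bound: in the eigencoordinates of a bounded lift, boxes of
   sides of order e lambda^-n and e stay e-small during n iterations, so that an
   (n, e)-separated set has O(lambda^n) points.

   Entropy, lower bound: the quotient by -1 makes T non expansive near the
   orbifold points, so one cannot simply lift separated sets.  On the unstable
   line t (lambda - 1, 1) the second coordinate of the k-th image is
   cos (lambda^k t), and cos x - cos y is bounded below when y - x and the
   distance from (x + y) / 2 to pi Z are.  An interval of length 1 has an outer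
   third far from pi Z; keeping in it about lambda^K / 6 separated intervals of
   length lambda^-K and iterating gives entropy at least
   ln lambda - ln 12 / K for every large K. *)
Require Import Defs.
From mathcomp Require Import all_boot all_order all_algebra all_fingroup.
From mathcomp Require Import all_classical all_reals all_analysis.
From mathcomp Require Import ring lra zify.
Import numFieldNormedType.Exports.
Import Order.TTheory GRing.Theory Num.Theory.
Local Open Scope classical_set_scope.
Local Open Scope ring_scope.

(** * Sine near the multiples of pi, and differences of cosines *)

Section Trigonometry.
Context {R : realType}.
Local Notation pi := (@trigo.pi R).

Lemma sinB_intpi (x : R) (k : int) : `|sin (x - pi * k%:~R)| = `|sin x|.
Proof.
have P (y : R) (n : nat) : `|sin (y + pi * n%:R)| = `|sin y|.
  elim: n => [|n IH]; first by rewrite mulr0 addr0.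
  by rewrite -natr1 mulrDr mulr1 addrA sinDpi normrN.
case: k => n; last by rewrite NegzE mulrNz mulrN opprK P.
by rewrite -[in RHS](subrK (pi * n%:R) x) P.
Qed.

Lemma nearest_intpi (x : R) : exists k : int, `|x - pi * k%:~R| <= pi / 2.
Proof.
exists (Num.floor (x / pi + 1 / 2)).
have := floor_itv (x / pi + 1 / 2); set k := Num.floor _.
have pi0 := pi_gt0 R.
rewrite intrD => /andP[k1 k2].
have -> : x - pi * k%:~R = pi * (x / pi + 1 / 2 - k%:~R) - pi / 2.
  by move: pi pi0 => p p0; field; rewrite gt_eqF.
have a1 : 0 <= pi * (x / pi + 1 / 2 - k%:~R).
  by rewrite mulr_ge0 ?subr_ge0 ?(ltW pi0).
have a2 : pi * (x / pi + 1 / 2 - k%:~R) <= pi * 1 by rewrite ler_pM2l//; lra.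
by rewrite ler_norml; apply/andP; split; lra.
Qed.

Lemma sin_norm (x : R) : `|x| <= pi / 2 -> sin `|x| = `|sin x|.
Proof.
have pi0 := pi_gt0 R.
rewrite ler_norml => /andP[x1 x2].
case: (lerP 0 x) => x0.
  by rewrite (ger0_norm x0) ger0_norm// sin_ge0_pi//; apply/andP; split; lra.
rewrite (ltr0_norm x0) -[in RHS]normrN -sinN ger0_norm// sin_ge0_pi//.
by apply/andP; split; lra.
Qed.

Lemma le_sin (x y : R) : 0 <= x -> x <= y -> y <= pi / 2 -> sin x <= sin y.
Proof.
have pi0 := pi_gt0 R.
move=> x0 xy ypi; rewrite leNgt ltr_sin ?in_itv /= -?leNgt//;
  apply/andP; split; lra.
Qed.

(** After reduction modulo pi to [[- pi / 2, pi / 2]], |sin| increases with the distance to 0, so a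
    distance at least [r] would force [sin r <= |sin x|]. *)
Lemma sin_small (r x : R) : 0 <= r -> `|sin x| < sin r ->
  exists k : int, `|x - pi * k%:~R| < r.
Proof.
move=> r0 xr; have [k kx] := nearest_intpi x; exists k.
rewrite ltNge; apply/negP => ry; move: xr; rewrite -(sinB_intpi x k).
by apply/negP; rewrite -leNgt -sin_norm// le_sin.
Qed.

Lemma sin_eq0_intpi (x : R) : sin x = 0 -> exists k : int, x = pi * k%:~R.
Proof.
move=> x0; have [k kx] := nearest_intpi x; exists k.
have pi0 := pi_gt0 R.
apply/eqP; rewrite -subr_eq0 -normr_eq0; apply/eqP/sin_inj.
- by rewrite in_itv /= kx andbT (le_trans _ (normr_ge0 _))//; lra.
- by rewrite in_itv /=; apply/andP; split; lra.
- by rewrite sin_norm// sinB_intpi x0 normr0 sin0.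
Qed.

Lemma cosB_sin (x y : R) :
  cos x - cos y = - (2 * (sin ((x + y) / 2) * sin ((x - y) / 2))).
Proof.
rewrite [X in cos X - _](_ : x = (x + y) / 2 + (x - y) / 2); last by field.
rewrite [X in _ - cos X](_ : y = (x + y) / 2 - (x - y) / 2); last by field.
by rewrite cosD cosB; ring.
Qed.

Lemma cos_eq_int2pi (x y : R) : cos x = cos y ->
  exists k : int, x = y + 2 * pi * k%:~R \/ x = - y + 2 * pi * k%:~R.
Proof.
move/eqP; rewrite -subr_eq0 cosB_sin oppr_eq0 !mulf_eq0 pnatr_eq0 /=.
by case/orP => /eqP/sin_eq0_intpi[k kE]; exists k; [right|left];
  rewrite -mulrA -kE; field.
Qed.

Lemma sin_le_norm (x : R) : `|sin x| <= `|x|.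
Proof.
suff H (y : R) : 0 <= y -> `|sin y| <= y.
  case: (lerP 0 x) => x0; first by rewrite [`|x|]ger0_norm ?H.
  by rewrite [`|x|]ltr0_norm // -normrN -sinN H// oppr_ge0 ltW.
move=> y0.
have [|c _] := @MVT_segment R sin cos 0 y y0 (fun x _ => is_derive_sin x).
  by apply: continuous_subspaceT => z; exact: continuous_sin.
rewrite sin0 !subr0 => ->; rewrite normrM [`|y|]ger0_norm//.
by rewrite ler_piMl// cos_max.
Qed.

Lemma cos_lipschitz (x y : R) : `|cos x - cos y| <= `|x - y|.
Proof.
rewrite cosB_sin normrN normrM normrM ger0_norm//.
have -> : `|x - y| = 2 * (1 * `|(x - y) / 2|).
  by rewrite mul1r normrM [`|2^-1|]ger0_norm; [field | rewrite invr_ge0].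
by rewrite ler_pM2l// ler_pM// ?sin_max ?sin_le_norm.
Qed.

(** If both failed, a point of each outer third would be within 1/6 of a multiple of pi. These
    points are between 1/3 and 1 apart, so the two multiples would be distinct and less than 4/3
    apart, whereas pi is at least 2. *)
Lemma sin_away_third (a : R) :
  (forall x, a <= x <= a + 1 / 3 -> sin (1 / 6) <= `|sin x|) \/
  (forall x, a + 2 / 3 <= x <= a + 1 -> sin (1 / 6) <= `|sin x|).
Proof.
apply: contrapT => /not_orP[/existsNP[x /not_implyP[/andP[x1 x2] /negP]] +].
rewrite -ltNge => /sin_small[|k kx]; first by rewrite divr_ge0.
move=> /existsNP[y /not_implyP[/andP[y1 y2] /negP]].
rewrite -ltNge => /sin_small[|l ly]; first by rewrite divr_ge0.
have pi2 := pi_ge2 R.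
move: kx ly; rewrite !ltr_norml => /andP[k1 k2] /andP[l1 l2].
have [kl|kl|kl] := ltgtP k l; last by move: l1 l2; rewrite -kl; lra.
- have : 1 <= l%:~R - k%:~R :> R by rewrite -intrB ler1z; lia.
  nra.
- have : 1 <= k%:~R - l%:~R :> R by rewrite -intrB ler1z; lia.
  nra.
Qed.

End Trigonometry.

(** * The projection of the plane onto the boundary *)

Section PlaneProjection.
Context {R : realType}.
Local Notation pi := (@trigo.pi R).
Implicit Types (xi eta : 'cV[R]_2).

Definition vec2 (x y : R) : 'cV[R]_2 := \col_i (if i == 0 then x else y).

Lemma vec2_0 (x y : R) : vec2 x y 0 0 = x. Proof. by rewrite mxE. Qed.

Lemma vec2_1 (x y : R) : vec2 x y 1 0 = y. Proof. by rewrite mxE. Qed.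

Lemma ord2P (i : 'I_2) : i = 0 \/ i = 1.
Proof. by case: i => [[|[|m]] hi] //; [left|right]; exact: val_inj. Qed.

Lemma cV2P xi eta : xi 0 0 = eta 0 0 -> xi 1 0 = eta 1 0 -> xi = eta.
Proof.
move=> e0 e1; apply/colP => i.
by have [->|->] := ord2P i.
Qed.

Lemma vec2E xi : xi = vec2 (xi 0 0) (xi 1 0).
Proof. by apply: cV2P; rewrite ?vec2_0 ?vec2_1. Qed.

Lemma cat_map0 xi : cat_map xi 0 0 = 2 * xi 0 0 + xi 1 0.
Proof.
rewrite mxE !big_ord_recl big_ord0 !mxE /= addr0 mul1r.
by congr (_ * xi _ 0 + xi _ 0); exact: val_inj.
Qed.

Lemma cat_map1 xi : cat_map xi 1 0 = xi 0 0 + xi 1 0.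
Proof.
rewrite mxE !big_ord_recl big_ord0 !mxE /= addr0 !mul1r.
by congr (xi _ 0 + xi _ 0); exact: val_inj.
Qed.

Definition to_boundary xi : trace_boundary R := torus_to_boundary (to_torus xi).

Lemma val_to_boundary xi : \val (to_boundary xi) = commuting_trace xi.
Proof. exact: pillow_to_boundaryE. Qed.

(** Put [a = acos x] and [b = acos y]: the equation of the boundary is quadratic in [z], with roots
    [cos (a + b)] and [cos (a - b)], and the second root is reached by changing the sign of [b]. The
    bounds on the lift serve for compactness and for counting boxes. *)
Lemma to_boundary_surj (p : trace_boundary R) :
  exists xi, [/\ `|xi 0 0| <= pi, `|xi 1 0| <= pi & to_boundary xi = p].
Proof.
suff [xi [xi0 xi1 xiE]] : exists xi,
    [/\ `|xi 0 0| <= pi, `|xi 1 0| <= pi & commuting_trace xi = \val p].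
  by exists xi; split=> //; apply: val_inj; rewrite val_to_boundary.
case: p => -[[x y] z] /= /set_mem[[hx hy hz _]].
move=> E; have [/andP[a0 api] aE] := acos_def hx.
have [/andP[b0 bpi] bE] := acos_def hy.
move: (acos x) (acos y) a0 api aE b0 bpi bE => a b a0 api aE b0 bpi bE.
have sa := cos2Dsin2 a; have sb := cos2Dsin2 b.
have : (z - cos (a + b)) * (z - cos (a - b)) = 0.
  rewrite cosD cosB aE bE.
  have -> : (z - (x * y - sin a * sin b)) * (z - (x * y + sin a * sin b)) =
     z ^+ 2 - 2 * x * y * z + (x * y) ^+ 2 - sin a ^+ 2 * sin b ^+ 2 by ring.
  have -> : sin a ^+ 2 = 1 - x ^+ 2 by rewrite -sa aE addrC addKr.
  have -> : sin b ^+ 2 = 1 - y ^+ 2 by rewrite -sb bE addrC addKr.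
  by rewrite -[RHS]oppr0 -E; ring.
move/eqP; rewrite mulf_eq0 !subr_eq0 => /orP[]/eqP ->.
  by exists (vec2 a b); rewrite /commuting_trace vec2_0 vec2_1 aE bE !ger0_norm.
exists (vec2 a (- b)).
by rewrite /commuting_trace vec2_0 vec2_1 cosN aE bE normrN !ger0_norm.
Qed.

(** The first two cosines determine each angle modulo 2 pi up to its own sign. If the two signs
    differ, the third cosine gives [sin a * sin b = 0], and an angle of zero sine is congruent to
    its opposite, so that a common sign can be chosen. *)
Lemma to_boundary_eq xi eta : to_boundary xi = to_boundary eta <->
  exists (s : bool) (m : 'cV[int]_2),
    eta = (-1) ^+ s *: xi + (2 * pi) *: map_mx intr m.
Proof.
split=> [|[s [m ->]]].
  move=> /(congr1 val); rewrite !val_to_boundary /commuting_trace.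
  suff H (a b c d : R) : cos a = cos c -> cos b = cos d ->
      cos (a + b) = cos (c + d) ->
      exists (s : bool) (k l : int), c = (-1) ^+ s * a + 2 * pi * k%:~R /\
        d = (-1) ^+ s * b + 2 * pi * l%:~R.
    move=> [e0 e1 e2]; have [s [k [l [ck dl]]]] := H _ _ _ _ e0 e1 e2.
    exists s, (\col_i (if i == 0 then k else l)).
    by apply: cV2P; rewrite !mxE.
  have dbl (z : R) : sin z = 0 -> exists k : int, - z = z + 2 * pi * k%:~R.
    move=> /sin_eq0_intpi[k ->]; exists (- k); rewrite mulrNz; ring.
  move=> /esym/cos_eq_int2pi[k ck] /esym/cos_eq_int2pi[l dl] e.
  case: ck dl => [ck|ck] [dl|dl].
  - by exists false, k, l; rewrite ck dl !mul1r.
  - have [/dbl[j bj]|/dbl[j aj]] : sin b = 0 \/ sin a = 0.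
    + move/eqP: e; rewrite ck dl.
      have -> : a + 2 * pi * k%:~R + (- b + 2 * pi * l%:~R)
         = a - b + 2 * pi * (k + l)%:~R by rewrite intrD; ring.
      rewrite cosD_int2pi cosD cosB -subr_eq0.
      have -> : cos a * cos b - sin a * sin b - (cos a * cos b + sin a * sin b)
         = - (2 * (sin a * sin b)) by ring.
      by rewrite oppr_eq0 !mulf_eq0 pnatr_eq0 /= => /orP[]/eqP; [right|left].
    + by exists false, k, (j + l); rewrite ck dl !mul1r bj intrD; split=> //; ring.
    + exists true, (k - j), l; rewrite ck dl !mulN1r aj intrB; split=> //; ring.
  - have [/dbl[j bj]|/dbl[j aj]] : sin b = 0 \/ sin a = 0.
    + move/eqP: e; rewrite ck dl.
      have -> : - a + 2 * pi * k%:~R + (b + 2 * pi * l%:~R)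
         = - (a - b) + 2 * pi * (k + l)%:~R by rewrite intrD; ring.
      rewrite cosD_int2pi cosN cosD cosB -subr_eq0.
      have -> : cos a * cos b - sin a * sin b - (cos a * cos b + sin a * sin b)
         = - (2 * (sin a * sin b)) by ring.
      by rewrite oppr_eq0 !mulf_eq0 pnatr_eq0 /= => /orP[]/eqP; [right|left].
    + exists true, k, (l - j); rewrite ck dl !mulN1r bj intrB; split=> //; ring.
    + by exists false, (j + k), l; rewrite ck dl !mul1r aj intrD; split=> //; ring.
  - by exists true, k, l; rewrite ck dl !mulN1r.
apply: val_inj; rewrite !val_to_boundary.
have -> : commuting_trace xi = commuting_trace ((-1) ^+ s *: xi).
  case: s; last by rewrite expr0 scale1r.
  by rewrite expr1 scaleN1r /commuting_trace !mxE -opprD !cosN.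
by apply: commuting_trace_torus; apply/to_torus_eq; exists (- m);
  rewrite opprD addNKr map_mxN scalerN.
Qed.

(** The polynomials of [trace_map] are two uses of cos (u + v) = 2 cos u cos v - cos (u - v), with
    (u, v) = (a, a + b) and then (a + b, 2 a + b). *)
Lemma boundary_map_to_boundary xi :
  boundary_map (to_boundary xi) = to_boundary (cat_map xi).
Proof.
apply: val_inj.
have valE p : \val (boundary_map p) = trace_map (\val p) by [].
rewrite valE !val_to_boundary.
rewrite /commuting_trace /trace_map cat_map0 cat_map1.
move: (xi 0 0) (xi 1 0) => a b.
have e1 : cos (2 * a + b) = 2 * cos a * cos (a + b) - cos b.
  rewrite (_ : 2 * a + b = a + (a + b)); last by ring.
  rewrite [in cos b](_ : b = (a + b) - a); last by ring.
  by rewrite cosD cosB; ring.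
congr (_, _, _) => //.
rewrite (_ : 2 * a + b + (a + b) = (a + b) + (2 * a + b)); last by ring.
rewrite [cos (a + b + _)]cosD.
have -> : sin (a + b) * sin (2 * a + b) =
  cos a - cos (a + b) * cos (2 * a + b).
  rewrite [in cos a](_ : a = (2 * a + b) - (a + b)); last by ring.
  by rewrite cosB; ring.
by rewrite e1; ring.
Qed.

Lemma iter_boundary_map n xi :
  iter n boundary_map (to_boundary xi) = to_boundary (iter n cat_map xi).
Proof. by elim: n => //= n ->; rewrite boundary_map_to_boundary. Qed.

Lemma ball_to_boundary xi eta (e : R) :
  ball (to_boundary xi) e (to_boundary eta) <->
  [/\ `|cos (xi 0 0) - cos (eta 0 0)| < e,
      `|cos (xi 1 0) - cos (eta 1 0)| < e &
      `|cos (xi 0 0 + xi 1 0) - cos (eta 0 0 + eta 1 0)| < e].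
Proof.
have -> : ball (to_boundary xi) e (to_boundary eta) =
  ball (\val (to_boundary xi)) e (\val (to_boundary eta)) by [].
by rewrite !val_to_boundary; split=> [[[]]|[]].
Qed.

End PlaneProjection.

(** * Topological entropy *)

Section CatEigenvalue.
Context {R : realType}.

Definition cat_eigenvalue : R := (3 + Num.sqrt 5) / 2.

Local Notation lambda := cat_eigenvalue.

(** This is the characteristic equation of [cat_matrix], of trace 3 and determinant 1. Eigenvectors
    and eigenforms are derived from this equation alone, hence for both eigenvalues at once. *)
Lemma cat_eigenvalue_sqr : lambda ^+ 2 = 3 * lambda - 1.
Proof.
have /sqr_sqrtr : 0 <= 5 :> R by [].
rewrite /lambda; move: (Num.sqrt 5) => s /eqP; rewrite -subr_eq0 => /eqP s5.
apply/eqP; rewrite -subr_eq0; apply/eqP.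
rewrite (_ : _ - _ = (s ^+ 2 - 5) / 4); last by field.
by rewrite s5 mul0r.
Qed.

Lemma cat_eigenvalue_gt2 : 2 < lambda.
Proof.
suff : 1 < Num.sqrt 5 :> R by rewrite /lambda; lra.
by rewrite -[X in X < _]sqrtr1 ltr_sqrt; lra.
Qed.

Lemma cat_eigenvalue_lt3 : lambda < 3.
Proof.
suff : Num.sqrt 5 < 3 :> R by rewrite /lambda; lra.
rewrite (_ : 3 = Num.sqrt (3 ^+ 2)); last by rewrite sqrtr_sqr ger0_norm.
by rewrite ltr_sqrt; lra.
Qed.

Lemma cat_eigenvalue_gt0 : 0 < lambda.
Proof. by have := cat_eigenvalue_gt2; lra. Qed.

Lemma cat_eigenvalueV : lambda^-1 = 3 - lambda.
Proof.
have l0 : lambda != 0 by rewrite gt_eqF// cat_eigenvalue_gt0.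
apply: (mulfI l0); rewrite mulfV// mulrBr -expr2 cat_eigenvalue_sqr; ring.
Qed.

End CatEigenvalue.

(** * Coding of points on a line whose cosines separate under multiplication by [mu] *)

Section Coding.
Context {R : realType}.
Variable mu : R.

(** The relative position of an outer third of [[a, a + 1]] that stays away from the multiples of
    pi. *)
Definition good_offset (a : R) : R :=
  if `[< forall x, a <= x <= a + 1 / 3 -> sin (1 / 6) <= `|sin x| >]
  then 0 else 2 / 3.

Lemma good_offsetP (a x : R) :
  good_offset a <= x - a <= good_offset a + 1 / 3 -> sin (1 / 6) <= `|sin x|.
Proof.
rewrite /good_offset; case: asboolP => [h /andP[h1 h2]|h /andP[h1 h2]].
  by apply: h; apply/andP; split; lra.
by case: (sin_away_third a) => // /(_ x); apply; apply/andP; split; lra.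
Qed.

(* The point of [a, a + 1] coded by a word: its first letter chooses a
   subinterval of length 1 / mu, and the homothety of ratio mu maps this
   subinterval to the unit interval in which the rest of the word is read. *)
Fixpoint coded_point (a : R) (w : seq nat) : R :=
  if w is j :: w' then
    coded_point (mu * (a + good_offset a) + 2 * j%:R) w' / mu
  else a.

(** A good third becomes an interval of length [mu / 3], at least [2 * N], under the homothety. It
    thus has room for [N] unit intervals starting at even distances, with gaps of length 1 between
    them. *)
Lemma coded_point_bounds N a w : (0 < N)%N -> 6 * N%:R <= mu ->
  all (fun j => (j < N)%N) w -> a <= coded_point a w <= a + 1.
Proof.
move=> N0 Nmu; elim: w a => [|j w IH] a /=; first by rewrite lexx lerDl ler01.
move=> /andP[jN /IH]; set p := _ + _ => /(_ p)/andP[].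
set y := coded_point p w => y1 y2.
have jN' : j%:R + 1 <= N%:R :> R by rewrite natr1 ler_nat.
have j0 : 0 <= j%:R :> R by [].
have mu0 : 0 < mu by lra.
have o0 : 0 <= good_offset a <= 2 / 3.
  by rewrite /good_offset; case: ifP => _; apply/andP; split; lra.
move: y1 y2; rewrite /p; move: (good_offset a) o0 => o /andP[c1 c2] y1 y2.
have m1 : 0 <= mu * o by rewrite mulr_ge0// ltW.
have m2 : mu * o <= mu * (2 / 3) by rewrite ler_pM2l.
by rewrite ler_pdivlMr// ler_pdivrMr//; apply/andP; split; lra.
Qed.

(** The lower bound that [cosB_sin] gives for two points at least [mu^-1] apart in the same good
    third: one factor for the midpoint, one for the half difference. *)
Definition code_gap : R := 2 * (sin (1 / 6) * sin (mu^-1 / 2)).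

Lemma code_gap_gt0 : 1 <= mu -> 0 < code_gap.
Proof.
move=> mu1; have pi2 := pi_ge2 R.
have mV0 : 0 < mu^-1 by rewrite invr_gt0; lra.
have mV1 : mu^-1 <= 1 by rewrite invf_le1; lra.
by rewrite !mulr_gt0// sin_gt0_pi//; apply/andP; split; lra.
Qed.

(** The index [i] is that of the first letter where the words differ: multiplying by [mu] strips a
    common letter. At this stage both points lie in the same good third, as does their midpoint, and
    the gap between the unit intervals keeps them [mu^-1] apart. *)
Lemma coded_point_separated N a (v w : seq nat) : (0 < N)%N -> 6 * N%:R <= mu ->
  all (fun j => (j < N)%N) v -> all (fun j => (j < N)%N) w ->
  size v = size w -> v <> w ->
  exists2 i, (i < size w)%N &
    code_gap <=
    `|cos (mu ^+ i * coded_point a v) - cos (mu ^+ i * coded_point a w)|.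
Proof.
move=> N0 Nmu; have N1 : 1 <= N%:R :> R by rewrite ler1n.
have mu0 : 0 < mu by lra.
elim: v w a => [|j v IH] [|k w] a //= /andP[jN vN] /andP[kN wN] [vw].
have [<-{k kN} nvw|jk _] := eqVneq j k.
  have {}nvw : v <> w by move=> e; apply: nvw; rewrite e.
  have [i iw hi] := IH w (mu * (a + good_offset a) + 2 * j%:R) vN wN vw nvw.
  exists i.+1 => //; rewrite !exprSr -!mulrA.
  by rewrite ![mu * (_ / mu)]mulrC !divfK ?gt_eqF.
exists 0%N => //; rewrite !expr0 !mul1r.
wlog jk' : j k v w jN kN vN wN jk {vw IH} / (j < k)%N.
  move=> H; have [lt|gt|e] := ltngtP j k; first exact: H.
    by rewrite distrC; apply: H => //; rewrite eq_sym.
  by rewrite e eqxx in jk.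
have kN' : k%:R + 1 <= N%:R :> R by rewrite natr1 ler_nat.
have jk'' : j%:R + 1 <= k%:R :> R by rewrite natr1 ler_nat.
have j0 : 0 <= j%:R :> R by [].
have := coded_point_bounds N (mu * (a + good_offset a) + 2 * j%:R) v N0 Nmu vN.
have := coded_point_bounds N (mu * (a + good_offset a) + 2 * k%:R) w N0 Nmu wN.
set x := coded_point _ v; set y := coded_point _ w => /andP[y1 y2] /andP[x1 x2].
have pi2 := pi_ge2 R.
have mV0 : 0 < mu^-1 by rewrite invr_gt0.
have D1 : mu^-1 <= y / mu - x / mu.
  rewrite -mulrBl -[X in X <= _]mul1r ler_pM2r ?invr_gt0//; lra.
have D2 : y / mu - x / mu <= 1 by rewrite -mulrBl ler_pdivrMr//; lra.
have D3 : a + good_offset a <= x / mu by rewrite ler_pdivlMr//; lra.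
have D4 : y / mu <= a + good_offset a + 1 / 3 by rewrite ler_pdivrMr//; lra.
rewrite distrC cosB_sin normrN normrM ger0_norm// /code_gap ler_pM2l// normrM.
apply: ler_pM.
- by rewrite sin_ge0_pi//; apply/andP; split; lra.
- by rewrite sin_ge0_pi//; apply/andP; split; lra.
- by apply: (good_offsetP a); apply/andP; split; lra.
- by apply: (le_trans _ (ler_norm _)); apply: le_sin; lra.
Qed.

End Coding.

(** * Lower bound for the entropy *)

Section EntropyLowerBound.
Context {R : realType}.
Local Notation lambda := (@cat_eigenvalue R).
Local Notation T := (@boundary_map R).

Lemma iter_cat_map_eigen (a : R) (v : 'cV[R]_2) (t : R) n :
  cat_map v = a *: v -> iter n cat_map (t *: v) = (a ^+ n * t) *: v.
Proof.
move=> av; elim: n => [|n IH]; first by rewrite mul1r.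
by rewrite iterS IH /cat_map -scalemxAr [_ *m v]av scalerA exprS mulrC mulrA.
Qed.

Lemma cat_eigenvector_vec2 (a : R) : a ^+ 2 = 3 * a - 1 ->
  cat_map (vec2 (a - 1) 1) = a *: vec2 (a - 1) 1.
Proof.
move=> a2; apply: cV2P; rewrite ?cat_map0 ?cat_map1 !mxE /=; last by ring.
have -> : a * (a - 1) = a ^+ 2 - a by ring.
by rewrite a2; ring.
Qed.

(** One step of the code is [K] iterations of the map, since [mu = lambda ^+ K]. On the line of the
    eigenvector the second trace coordinate at time [i * K] is the cosine of [mu ^+ i] times the
    coded point, so this coordinate alone separates the [N ^ m] words. *)
Lemma separated_coding K N m : (0 < N)%N -> 6 * N%:R <= lambda ^+ K ->
  (0 < K)%N ->
  exists2 s : seq (trace_boundary R),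
    Defs.separated T (m * K) (code_gap (lambda ^+ K)) s & size s = (N ^ m)%N.
Proof.
move=> N0 Nmu K0; set mu := lambda ^+ K.
pose t (w : m.-tuple 'I_N) := coded_point mu 0 [seq val j | j <- w].
pose g (w : m.-tuple 'I_N) := to_boundary (t w *: vec2 (lambda - 1) 1).
have N1 : 1 <= N%:R :> R by rewrite ler1n.
have gap0 : 0 < code_gap mu by apply: code_gap_gt0; rewrite /mu; lra.
have gsep w w' : w <> w' -> exists2 k, (k < m * K)%N &
    ~ ball (iter k T (g w)) (code_gap mu) (iter k T (g w')).
  move=> ww'.
  have wN (u : m.-tuple 'I_N) : all (fun j => (j < N)%N) [seq val j | j <- u].
    by rewrite all_map; apply/allP => j _ /=.
  have := @coded_point_separated R mu N 0 _ _ N0 Nmu (wN w) (wN w').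
  rewrite !size_map !size_tuple => /(_ erefl)[].
    by move/(inj_map val_inj)/val_inj.
  move=> i im hi; exists (i * K)%N; first by rewrite ltn_pmul2r.
  have eig := cat_eigenvector_vec2 _ (@cat_eigenvalue_sqr R).
  rewrite !iter_boundary_map !(iter_cat_map_eigen _ _ _ _ eig).
  move=> /ball_to_boundary[_ + _].
  by rewrite !mxE /= !mulr1 mulnC exprM ltNge hi.
have ginj : injective g.
  move=> w w' ww'; apply: contrapT => /gsep[k _]; apply; rewrite ww'.
  exact: ballxx.
exists [seq g w | w <- enum {: m.-tuple 'I_N}].
  split; first by rewrite map_inj_uniq ?enum_uniq.
  move=> x y /mapP[w _ ->] /mapP[w' _ ->] xy; apply: gsep => ww'.
  by apply: xy; rewrite ww'.
by rewrite size_map -cardE card_tuple card_ord.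
Qed.

(** The upper limit is an infimum over sets of times containing a tail. Each of them contains a
    positive multiple of [K], where the coding already has the rate [ln N / K]. *)
Lemma separated_growth_ge K N : (0 < N)%N -> 6 * N%:R <= lambda ^+ K ->
  (0 < K)%N ->
  ((ln N%:R / K%:R)%:E <= separated_growth T (code_gap (lambda ^+ K)))%E.
Proof.
move=> N0 NK K0; apply: le_ereal_inf_tmp => _ [V [n0 _ nV] <-].
apply: (@le_trans _ _ (ln (N ^ n0.+1)%:R / (n0.+1 * K)%:R)%:E).
  rewrite natrX lnXn ?ltr0n// -[ln _ *+ _]mulr_natl natrM lee_fin.
  by rewrite -mulf_div divff ?pnatr_eq0// mul1r.
have [s ss <-] := separated_coding K N n0.+1 N0 NK K0.
apply: le_trans (ereal_sup_ubound _); last first.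
  exists (n0.+1 * K)%N => //; apply: nV => /=.
  exact: leq_trans (leqnSn _) (leq_pmulr _ K0).
by apply: ereal_sup_ubound; exists s.
Qed.

Lemma topological_entropy_ge : ((ln lambda)%:E <= topological_entropy T)%E.
Proof.
apply/lee_subgt0Pr => e e0.
have l2 := @cat_eigenvalue_gt2 R.
have ln12 : 0 <= ln 12 :> R by rewrite ln_ge0// ler1n.
(* The second condition makes the loss [ln 12 / K] smaller than [e]. The third makes the integer
   part [N] of [lambda ^+ K / 6] positive, with [lambda ^+ K <= 12 * N]; the summand 4 in the
   witness secures it, because [2 ^+ 4] exceeds 12. *)
have [K [K0' Ke lK]] : exists K,
    [/\ (0 < K)%N, ln 12 / e < K%:R & 12 <= lambda ^+ K].
  exists (4 + (Num.truncn (ln 12 / e)).+1)%N; split => //.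
    apply: lt_le_trans (truncnS_gt _) _; rewrite ler_nat; exact: leq_addl.
  rewrite exprD -[12]mulr1; apply: ler_pM => //; last by apply: exprn_ege1; lra.
  apply: (@le_trans _ _ (2 ^+ 4)); first by rewrite -natrX ler_nat.
  by rewrite ler_pXn2r ?nnegrE//; lra.
have [N [N1 N2]] : exists N, N%:R <= lambda ^+ K / 6 /\ lambda ^+ K / 6 < N%:R + 1.
  exists (Num.truncn (lambda ^+ K / 6)); rewrite natr1; apply/andP/truncn_itv.
  by apply: divr_ge0 => //; lra.
have N0 : (0 < N)%N by rewrite -(ltr_nat R); lra.
have K0 : 0 < K%:R :> R by rewrite ltr0n.
have NK : 6 * N%:R <= lambda ^+ K by lra.
apply: le_trans (ereal_sup_ubound _); last first.
  exists (code_gap (lambda ^+ K)) => //=; apply: code_gap_gt0; lra.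
apply: le_trans (separated_growth_ge K N N0 NK _) => //.
rewrite -EFinB lee_fin ler_pdivlMr//.
have h12 : lambda ^+ K <= 12 * N%:R by lra.
have : ln (lambda ^+ K) <= ln (12 * N%:R).
  by rewrite ler_ln// posrE; lra.
rewrite lnM ?posrE ?ltr0n// lnXn; last exact: cat_eigenvalue_gt0.
move: Ke; rewrite ltr_pdivrMr// -[ln _ *+ _]mulr_natl; lra.
Qed.

End EntropyLowerBound.

(** * Upper bound for the entropy *)

Section EntropyUpperBound.
Context {R : realType}.
Local Notation pi := (@trigo.pi R).
Local Notation lambda := (@cat_eigenvalue R).
Local Notation T := (@boundary_map R).
Implicit Types xi eta : 'cV[R]_2.

(** For an eigenvalue [a] this is a left eigenvector of the matrix; by symmetry of the matrix it has
    the entries of the eigenvector [vec2 (a - 1) 1]. *)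
Definition eigenform (a : R) xi : R := (a - 1) * xi 0 0 + xi 1 0.

Lemma eigenform_cat_map (a : R) n xi : a ^+ 2 = 3 * a - 1 ->
  eigenform a (iter n cat_map xi) = a ^+ n * eigenform a xi.
Proof.
move=> a2; elim: n => [|n IH]; first by rewrite mul1r.
rewrite iterS exprS -mulrA -IH; move: (iter n cat_map xi) => eta.
rewrite /eigenform cat_map0 cat_map1.
rewrite [RHS](_ : _ = (a ^+ 2 - a) * eta 0 0 + a * eta 1 0); last by ring.
by rewrite a2; ring.
Qed.

(** Subtracting the two forms leaves [2 * lambda - 3], which exceeds 1, times the first coordinate.
    The coordinates therefore differ by less than [2 * d] and [5 * d], their sum by less than
    [7 * d], and cosine is 1-Lipschitz. *)
Lemma eigenform_close (d : R) xi eta :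
  `|eigenform lambda xi - eigenform lambda eta| < d ->
  `|eigenform lambda^-1 xi - eigenform lambda^-1 eta| < d ->
  ball (to_boundary xi) (8 * d) (to_boundary eta).
Proof.
rewrite cat_eigenvalueV /eigenform; have l2 := @cat_eigenvalue_gt2 R.
have l3 := @cat_eigenvalue_lt3 R.
move: (lambda) l2 l3 => l l2 l3.
set x := xi 0 0; set y := xi 1 0; set x' := eta 0 0; set y' := eta 1 0.
rewrite !ltr_norml => /andP[u1 u2] /andP[w1 w2].
have x1 : x - x' < 2 * d.
  rewrite ltNge; apply/negP => h.
  have : 1 * (2 * d) <= (2 * l - 3) * (x - x') by apply: ler_pM; lra.
  lra.
have x2 : - (2 * d) < x - x'.
  rewrite ltNge; apply/negP => h.
  have : 1 * (2 * d) <= (2 * l - 3) * (x' - x) by apply: ler_pM; lra.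
  lra.
have y1 : y - y' < 5 * d.
  have : (l - 1) * (x' - x) <= 2 * (2 * d).
    have [p|p] := leP 0 (x' - x); first by apply: ler_pM; lra.
    by have : (l - 1) * (x' - x) <= 0 by [apply: mulr_ge0_le0; lra]; lra.
  lra.
have y2 : - (5 * d) < y - y'.
  have : (l - 1) * (x - x') <= 2 * (2 * d).
    have [p|p] := leP 0 (x - x'); first by apply: ler_pM; lra.
    by have : (l - 1) * (x - x') <= 0 by [apply: mulr_ge0_le0; lra]; lra.
  lra.
apply/ball_to_boundary; split; apply: le_lt_trans (cos_lipschitz _ _) _;
  by rewrite -/x -/y -/x' -/y' ltr_norml; apply/andP; split; lra.
Qed.

(** Since [pi < 4] and [|a - 1| <= 2], the form is at most [2 * 4 + 4] in absolute value. The shift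
    by 12 makes it nonnegative, as truncation to a box index requires. *)
Lemma eigenform_bounded (a : R) xi : 0 <= a <= 3 ->
  `|xi 0 0| <= pi -> `|xi 1 0| <= pi -> 0 <= eigenform a xi + 12 <= 24.
Proof.
move=> /andP[a0 a3]; have pi2 := pihalf_lt2 R.
rewrite !ler_norml /eigenform => /andP[x1 x2] /andP[y1 y2].
have [a1|a1] := leP 0 (a - 1).
  have : `|(a - 1) * xi 0 0| <= 2 * 4.
    by rewrite normrM; apply: ler_pM => //; rewrite ler_norml; apply/andP; split; lra.
  by rewrite ler_norml => /andP[z1 z2]; apply/andP; split; lra.
have : `|(a - 1) * xi 0 0| <= 2 * 4.
  by rewrite normrM; apply: ler_pM => //; rewrite ler_norml; apply/andP; split; lra.
by rewrite ler_norml => /andP[z1 z2]; apply/andP; split; lra.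
Qed.

Lemma same_box (d a b : R) : 0 < d -> 0 <= a -> 0 <= b ->
  Num.truncn (a / d) = Num.truncn (b / d) -> `|a - b| < d.
Proof.
move=> d0 a0 b0 E.
have /andP[a1 a2] : (Num.truncn (a / d))%:R <= a / d < (Num.truncn (a / d)).+1%:R.
  by apply: truncn_itv; rewrite divr_ge0// ltW.
have /andP[b1 b2] : (Num.truncn (b / d))%:R <= b / d < (Num.truncn (b / d)).+1%:R.
  by apply: truncn_itv; rewrite divr_ge0// ltW.
move: a1 a2 b1 b2; rewrite E -natr1; move: (Num.truncn _)%:R => t.
rewrite ler_pdivlMr// ltr_pdivrMr// ler_pdivlMr// ltr_pdivrMr// !mulrDl mul1r.
by move=> a1 a2 b1 b2; rewrite ltr_norml; apply/andP; split; lra.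
Qed.

(** Boxes have side [d / lambda ^+ n] in the expanded form and [d] in the contracted one. Lifts in a
    common box keep both forms within [d] at all times before [n], so their images stay within
    [8 * d = e]: a separated set has at most one point per box. *)
Lemma separated_size n (e : R) (s : seq (trace_boundary R)) : 0 < e ->
  Defs.separated T n e s ->
  (size s)%:R <= (24 / (e / 8) + 1) ^+ 2 * lambda ^+ n.
Proof.
move=> e0 [us hs]; set d := e / 8; have d0 : 0 < d by rewrite /d; lra.
have l2 := @cat_eigenvalue_gt2 R; have l3 := @cat_eigenvalue_lt3 R.
have lV : 0 <= lambda^-1 <= 3.
  by rewrite cat_eigenvalueV; apply/andP; split; lra.
have lV1 : 0 < lambda^-1 < 1.
  by rewrite cat_eigenvalueV; apply/andP; split; lra.
have l03 : 0 <= lambda <= 3 by apply/andP; split; lra.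
have ln1 : 1 <= lambda ^+ n by apply: exprn_ege1; lra.
pose lift (p : trace_boundary R) := sval (cid (to_boundary_surj p)).
have liftP p : [/\ `|lift p 0 0| <= pi, `|lift p 1 0| <= pi &
    to_boundary (lift p) = p] by exact: svalP (cid (to_boundary_surj p)).
pose boxes (r : R) := (Num.truncn (24 / r)).+1.
pose box (a r : R) p : 'I_(boxes r) :=
  inord (Num.truncn ((eigenform a (lift p) + 12) / r)).
have boxE (a r : R) p q : 0 < r -> 0 <= a <= 3 -> box a r p = box a r q ->
    `|eigenform a (lift p) - eigenform a (lift q)| < r.
  move=> r0 a3 /(congr1 val).
  have [p0 p1 _] := liftP p; have [q0 q1 _] := liftP q.
  have /andP[x0 x1] := eigenform_bounded _ _ a3 p0 p1.
  have /andP[y0 y1] := eigenform_bounded _ _ a3 q0 q1.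
  (* The shifted forms are at most 24, so their indices are below [boxes r] and [inord] leaves them
     unchanged. *)
  rewrite /= !inordK; last 2 first.
  - by rewrite ltnS; apply: le_truncn; rewrite ler_pM2r ?invr_gt0.
  - by rewrite ltnS; apply: le_truncn; rewrite ler_pM2r ?invr_gt0.
  move/(same_box _ _ _ r0 x0 y0).
  by congr (`|_| < _); ring.
have boxes_le (r : R) : 0 < r -> (boxes r)%:R <= 24 / r + 1.
  move=> r0; rewrite /boxes -natr1 lerD2r.
  by have /andP[] : (Num.truncn (24 / r))%:R <= 24 / r < (Num.truncn (24 / r)).+1%:R
    by apply: truncn_itv; rewrite divr_ge0// ltW.
pose r := d / lambda ^+ n.
have r0 : 0 < r by rewrite divr_gt0//; lra.
pose f p := (box lambda r p, box lambda^-1 d p).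
have finj : {in s &, injective f}.
  move=> p q ps qs [pq1 pq2]; apply: contrapT => /(hs p q ps qs)[k kn].
  apply; have [_ _ <-] := liftP p; have [_ _ <-] := liftP q.
  have {}pq1 := boxE _ _ _ _ r0 l03 pq1.
  have {}pq2 := boxE _ _ _ _ d0 lV pq2.
  rewrite !iter_boundary_map (_ : e = 8 * d); last by rewrite /d; field.
  apply: eigenform_close; rewrite !eigenform_cat_map ?cat_eigenvalue_sqr//;
    last 2 first.
  - by rewrite cat_eigenvalueV sqrrB cat_eigenvalue_sqr; ring.
  - by rewrite cat_eigenvalueV sqrrB cat_eigenvalue_sqr; ring.
  - rewrite -mulrBr normrM ger0_norm ?exprn_ge0//; last lra.
    apply: le_lt_trans (_ : lambda ^+ n * _ < _).
      by apply: ler_wpM2r => //; apply: ler_weXn2l; [lra|exact: ltnW].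
    by rewrite -ltr_pdivlMl; [rewrite mulrC|lra].
  - rewrite -mulrBr normrM ger0_norm ?exprn_ge0//; last lra.
    apply: le_lt_trans pq2; rewrite ler_piMl// exprn_ile1//; lra.
have : (size s <= boxes r * boxes d)%N.
  have /card_uniqP fs : uniq [seq f p | p <- s] by rewrite map_inj_in_uniq.
  rewrite -(size_map f) -fs; apply: leq_trans (max_card _) _.
  by rewrite card_prod !card_ord.
rewrite -(ler_nat R) natrM => /le_trans; apply.
rewrite expr2 mulrAC; apply: ler_pM => //; last exact: boxes_le.
(* Here [24 / r] equals [24 / d * lambda ^+ n], and the remaining 1 is absorbed by [lambda ^+ n]. *)
apply: le_trans (boxes_le _ r0) _.
rewrite (_ : (24 / d + 1) * lambda ^+ n = 24 / r + lambda ^+ n) ?lerD2l//.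
by rewrite /r; field; rewrite !gt_eqF//; lra.
Qed.

(** The factor [C] in the count of boxes does not depend on [n], so it adds only [ln C / n] to the
    rate, at most [c] on the tail from [N] on. *)
Lemma topological_entropy_le : (topological_entropy T <= (ln lambda)%:E)%E.
Proof.
apply: ge_ereal_sup => _ [e /= e0 <-].
apply/lee_addgt0Pr => c c0.
set C := (24 / (e / 8) + 1) ^+ 2.
have l2 := @cat_eigenvalue_gt2 R.
have C1 : 1 <= C by rewrite exprn_ege1// lerDr !divr_ge0// ltW.
have lnC : 0 <= ln C by rewrite ln_ge0.
have lnl : 0 <= ln lambda by rewrite ln_ge0//; lra.
have [N NC] : exists N, ln C / c < N%:R.
  by exists (Num.truncn (ln C / c)).+1; exact: truncnS_gt.
apply: (@le_trans _ _ (ereal_sup [set ereal_sup [set (ln (size s)%:R / n%:R)%:E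
    | s in Defs.separated T n e] | n in [set n | (N <= n)%N]])).
  by apply: ereal_inf_lbound; exists [set n | (N <= n)%N] => //; exists N.
apply: ge_ereal_sup => _ [n /= Nn <-].
apply: ge_ereal_sup => _ [s ss <-].
rewrite -EFinD lee_fin.
(* At time 0 the quotient is 0, the inverse of 0 being 0; likewise an empty set contributes 0 below,
   because [ln 0] is 0. *)
case: n Nn ss => [|n] Nn ss; first by rewrite invr0 mulr0; lra.
have n0 : 0 < n.+1%:R :> R by rewrite ltr0n.
rewrite ler_pdivrMr//.
have cN : ln C <= c * n.+1%:R.
  have : N%:R <= n.+1%:R :> R by rewrite ler_nat.
  by move: NC; rewrite ltr_pdivrMr//; nra.
have [->|s0] := posnP (size s); first by rewrite ln0// mulr_ge0//; lra.
have sz := separated_size _ _ _ e0 ss.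
have : ln (size s)%:R <= ln (C * lambda ^+ n.+1).
  by rewrite ler_ln// posrE ?ltr0n// (lt_le_trans _ sz)// ltr0n.
have l0 := @cat_eigenvalue_gt0 R.
have C0 : 0 < C by lra.
rewrite lnM ?posrE; [|exact: C0|exact: exprn_gt0].
rewrite (lnXn _ l0) -[ln lambda *+ _]mulr_natl; lra.
Qed.

Lemma topological_entropy_boundary_map :
  topological_entropy T = (ln lambda)%:E.
Proof.
by apply/eqP; rewrite eq_le topological_entropy_le topological_entropy_ge.
Qed.

End EntropyUpperBound.

(** * Periodic points *)

Lemma det_mx22 {S : comNzRingType} (A : 'M[S]_2) :
  \det A = A 0 0 * A 1 1 - A 0 1 * A 1 0.
Proof.
rewrite (expand_det_row A 0) !big_ord_recl big_ord0 addr0.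
rewrite /cofactor !det_mx11 !mxE /= expr0 expr1 mul1r mulN1r mulrN.
by congr (_ * A _ _ - A _ _ * A _ _); apply: val_inj.
Qed.

Lemma continuous_pair {S U V : topologicalType} (f : S -> U) (g : S -> V) x :
  {for x, continuous f} -> {for x, continuous g} ->
  {for x, continuous (fun t => (f t, g t))}.
Proof.
move=> cf cg.
exact: (@cvg_pair _ _ _ (nbhs x) (nbhs (f x)) (nbhs (g x)) _ _ _ _ _ cf cg).
Qed.

Section PeriodicPoints.
Context {R : realType}.
Local Notation pi := (@trigo.pi R).
Implicit Types xi eta : 'cV[R]_2.

Lemma nbhs_cV2P xi (A : set 'cV[R]_2) : nbhs xi A <->
  exists2 e : R, 0 < e & forall eta, `|xi 0 0 - eta 0 0| < e ->
    `|xi 1 0 - eta 1 0| < e -> A eta.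
Proof.
split=> [/nbhs_ballP[e /= e0 eA]|[e e0 eA]].
  exists e => // eta h0 h1; apply: eA; split=> // i j.
  rewrite (ord1 j).
  by have [->|->] := ord2P i.
by apply/nbhs_ballP; exists e => //= eta [_ h]; apply: eA; apply: h.
Qed.

Lemma coord0_continuous : continuous (fun xi => xi 0 0).
Proof.
move=> xi A /nbhs_ballP[e /= e0 eA]; apply/nbhs_cV2P.
by exists e => // eta h _; apply: eA.
Qed.

Lemma coord1_continuous : continuous (fun xi => xi 1 0).
Proof.
move=> xi A /nbhs_ballP[e /= e0 eA]; apply/nbhs_cV2P.
by exists e => // eta _ h; apply: eA.
Qed.

Lemma to_boundary_continuous : continuous (@to_boundary R).
Proof.
apply: continuous_comp_initial.
have -> : set_val \o @to_boundary R = commuting_trace.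
  by apply/funext => xi /=; rewrite -val_to_boundary.
move=> xi; apply: continuous_pair.
  apply: continuous_pair.
    apply: (@continuous_comp _ _ _ (fun xi => xi 0 0) cos).
      exact: coord0_continuous.
    exact: continuous_cos.
  apply: (@continuous_comp _ _ _ (fun xi => xi 1 0) cos).
      exact: coord1_continuous.
    exact: continuous_cos.
apply: (@continuous_comp _ _ _ (fun xi => xi 0 0 + xi 1 0) cos).
  exact: (@cvgD _ _ _ (nbhs xi) _ _ _ _ _
    (coord0_continuous xi) (coord1_continuous xi)).
exact: continuous_cos.
Qed.

(** Modulo [p] the matrix has determinant 1, hence is a unit of a finite ring; [n] is its order in
    the group of units. *)
Lemma cat_matrix_periodic (p : nat) : prime p ->
  exists2 n, (0 < n)%N &
    exists B : 'M[int]_2, cat_matrix ^+ n = 1 + p%:Z *: B.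
Proof.
move=> pp; pose A : 'M['F_p]_2 := map_mx intr cat_matrix.
have uA : A \is a GRing.unit.
  rewrite -[_ \is a GRing.unit]/(A \in unitmx) unitmxE det_mx22 !mxE /=.
  by rewrite (_ : _ - _ = 1) ?unitr1//; ring.
pose u := FinRing.Unit uA.
exists #[u]%g; first exact: order_gt0.
have An : A ^+ #[u]%g = 1.
  by have := congr1 val (expg_order u); rewrite FinRing.val_unitX.
have pA : map_mx intr (cat_matrix ^+ #[u]%g - 1) = 0 :> 'M['F_p]_2.
  by rewrite rmorphB rmorphXn rmorph1 /= -/A An subrr.
exists (\matrix_(i, j) ((cat_matrix ^+ #[u]%g - 1) i j %/ p%:Z)%Z).
apply/eqP; rewrite addrC -subr_eq; apply/eqP/matrixP => i j.
rewrite [RHS]mxE [X in _ * X]mxE mulrC divzK//.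
rewrite (dvdz_pcharf (pchar_Fp pp)).
by have /matrixP/(_ i j) := pA; rewrite !mxE => ->.
Qed.

Lemma iter_cat_map n xi :
  iter n cat_map xi = map_mx intr (cat_matrix ^+ n) *m xi.
Proof.
elim: n => [|n IH]; first by rewrite expr0 map_mx1 mul1mx.
by rewrite iterS IH /cat_map exprS map_mxM mulmxA.
Qed.

(** A lattice point [eta = (2 pi / p) m] is moved by [cat_matrix ^+ n = 1 + p B] to
    [eta + 2 pi B m], which has the same image. Rounding down the coordinates of a lift gives such a
    point within [2 pi / p], so a large prime suffices. *)
Lemma dense_periodic_points : dense (periodic_points (@boundary_map R)).
Proof.
move=> O [y Oy] oO; have [xi [_ _ xiy]] := to_boundary_surj y.
have : nbhs xi (@to_boundary R @^-1` O).
  by apply: to_boundary_continuous; rewrite xiy; exact: open_nbhs_nbhs.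
move=> /nbhs_cV2P[e e0 eO].
have [p pbig pp] := prime_above (Num.truncn (2 * pi / e)).
have pi0 := pi_gt0 R.
have p0 : 0 < p%:R :> R by rewrite ltr0n prime_gt0.
have pe : 2 * pi / p%:R < e.
  rewrite ltr_pdivrMr// [e * _]mulrC -ltr_pdivrMr//.
  by apply: lt_le_trans (truncnS_gt _) _; rewrite ler_nat.
pose m : 'cV[int]_2 := \col_i Num.floor (xi i 0 * (p%:R / (2 * pi))).
pose eta : 'cV[R]_2 := (2 * pi / p%:R) *: map_mx intr m.
have close i : `|xi i 0 - eta i 0| < e.
  rewrite !mxE; have /andP[f1 f2] := floor_itv (xi i 0 * (p%:R / (2 * pi))).
  rewrite intrD in f2.
  set f := (Num.floor _)%:~R in f1 f2 *.
  have c0 : 0 < p%:R / (2 * pi) by rewrite divr_gt0// mulr_gt0.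
  rewrite -invf_div; rewrite -invf_div in pe.
  move: (p%:R / (2 * pi)) c0 f f1 f2 pe => c c0 f f1 f2 pe.
  have -> : xi i 0 - c^-1 * f = c^-1 * (xi i 0 * c - f).
    by field; rewrite gt_eqF.
  rewrite normrM [`|c^-1|]ger0_norm ?invr_ge0 ?ltW//.
  apply: le_lt_trans pe; rewrite ler_piMr ?invr_ge0 ?(ltW c0)// ler_norml.
  by apply/andP; split; lra.
exists (to_boundary eta); split; first exact: eO.
have [n n0 [B AB]] := cat_matrix_periodic p pp.
exists n => //; rewrite iter_boundary_map; apply/to_boundary_eq.
exists false, (- (B *m m)); rewrite expr0 scale1r iter_cat_map AB.
rewrite map_mxD map_mx1 mulmxDl mul1mx map_mxZ -scalemxAl -scalemxAr -map_mxM.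
rewrite scalerA map_mxN scalerN mulrC divfK ?gt_eqF//.
by rewrite addrK.
Qed.

End PeriodicPoints.

(** * Topology of the torus and of the pillowcase *)

Lemma open_image_nbhs {X Y : topologicalType} (f : X -> Y) :
  (forall V, open V -> open (f @` V)) ->
  forall x A, nbhs x A -> nbhs (f x) (f @` A).
Proof.
move=> fo x A; rewrite nbhsE => -[U [oU Ux] UA].
have : nbhs (f x) (f @` U).
  by apply: open_nbhs_nbhs; split; [exact: fo|exists x].
by apply: filterS; exact: image_subset.
Qed.

(** The preimage of a closed set under the inverse is its image under [f], which is compact and
    therefore closed. *)
Lemma compact_homeomorphism {X Y : topologicalType} (f : X -> Y) :
  compact [set: X] -> hausdorff_space Y -> continuous f -> injective f ->
  (forall y, exists x, f x = y) -> homeomorphism f.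
Proof.
move=> cX hY cf fi fs; split=> //.
pose g y := sval (cid (fs y)).
have gK : cancel g f by move=> y; exact: svalP (cid (fs y)).
have fK : cancel f g by move=> x; exact/fi/gK.
exists g; split=> //; apply/continuous_closedP => A cA.
rewrite (_ : g @^-1` A = f @` A); last first.
  apply/seteqP; split=> [y /= Ay|_ [x Ax <-]]; last by rewrite /= fK.
  by exists (g y) => //; exact: gK.
apply: compact_closed => //; apply: continuous_compact.
  exact: continuous_subspaceT.
by apply: subclosed_compact cX _.
Qed.

Section TorusTopology.
Context {R : realType}.
Local Notation pi := (@trigo.pi R).
Implicit Types (xi eta : 'cV[R]_2) (V : set 'cV[R]_2).

Lemma affine_continuous (a : R) (b : 'cV[R]_2) :
  continuous (fun xi => a *: xi + b).
Proof.
move=> xi; apply: continuousD; last exact: cst_continuous.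
exact: scaler_continuous.
Qed.

Lemma to_torus_continuous : continuous (@to_torus R).
Proof. exact: pi_continuous. Qed.

(** The saturation of [V] is the union of its translates by the period lattice. *)
Lemma to_torus_open V : open V -> open (@to_torus R @` V).
Proof.
move=> oV; rewrite /open /= /quotient_open.
rewrite (_ : _ @^-1` _ = \bigcup_(m : 'cV[int]_2)
    ((fun xi => 1 *: xi + (2 * pi) *: map_mx intr m) @^-1` V)).
  apply: bigcup_open => m _; apply: open_comp oV => xi _.
  exact: affine_continuous.
apply/seteqP; split=> [xi /= [eta Veta] /to_torus_eq[m mE]|xi [m _ /= Vm]].
  by exists m => //=; rewrite scale1r -mE addrC subrK.
exists (1 *: xi + (2 * pi) *: map_mx intr m) => //; apply/to_torus_eq.
by exists m; rewrite scale1r addrAC subrr add0r.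
Qed.

Lemma torus_opp_continuous : continuous (@torus_opp R).
Proof.
apply/quotient_continuous.
rewrite (_ : _ \o _ = @to_torus R \o (fun xi => -1 *: xi + 0)).
  move=> xi; apply: continuous_comp; first exact: affine_continuous.
  exact: to_torus_continuous.
by apply/funext => xi /=; rewrite addr0 scaleN1r -torus_oppE.
Qed.

Lemma to_pillow_open (U : set (torus R)) : open U -> open (@to_pillow R @` U).
Proof.
move=> oU; rewrite /open /= /quotient_open.
rewrite (_ : _ @^-1` _ = U `|` @torus_opp R @^-1` U).
  apply: openU => //; apply: open_comp oU => p _; exact: torus_opp_continuous.
apply/seteqP; split=> [p /= [q Uq /to_pillow_eq[<-|qE]]|p /= [Up|Up]].
- by left.
- by right; rewrite /= -qE.
- by exists p.
- by exists (torus_opp p) => //; apply/to_pillow_eq; right.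
Qed.

Lemma pillow_to_boundary_inj : injective (@pillow_to_boundary R).
Proof.
move=> P Q; rewrite -(pillow_reprK P) -(pillow_reprK Q).
rewrite -(torus_reprK (pillow_repr P)) -(torus_reprK (pillow_repr Q)).
move: (torus_repr _) (torus_repr _) => xi eta.
rewrite -!/(torus_to_boundary _) -!/(to_boundary _) => /to_boundary_eq[s [m ->]].
apply/to_pillow_eq; case: s; [right|left].
  rewrite torus_oppE; apply/to_torus_eq; exists m.
  by rewrite expr1 scaleN1r opprK addNKr.
apply/to_torus_eq; exists (- m).
by rewrite expr0 scale1r opprD addNKr map_mxN scalerN.
Qed.

(** The square of side [2 * pi] covers it: the bounded lifts of [to_boundary_surj] carry over by
    injectivity of [pillow_to_boundary]. *)
Lemma pillow_compact : compact [set: pillowcase R].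
Proof.
pose sq : set (R * R) := `[- pi, pi] `*` `[- pi, pi].
pose h (z : R * R) := @to_pillow R (to_torus (vec2 z.1 z.2)).
have hc : continuous h.
  move=> z; apply: (@continuous_comp _ _ _ (fun z : R * R => vec2 z.1 z.2)
    (@to_pillow R \o @to_torus R)); last first.
    by apply: continuous_comp; [exact: pi_continuous|exact: pi_continuous].
  move=> A /nbhs_cV2P[e e0 eA]; apply/nbhs_ballP; exists e => //= w [w1 w2].
  by apply: eA; rewrite ?vec2_0 ?vec2_1.
rewrite (_ : [set: _] = h @` sq).
  apply: continuous_compact; first exact: continuous_subspaceT.
  by apply: compact_setX; exact: segment_compact.
apply/seteqP; split=> // P _.
have [xi [x0 x1 xiP]] := to_boundary_surj (pillow_to_boundary P).
exists (xi 0 0, xi 1 0); last first.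
  by rewrite /h /= -vec2E; apply: pillow_to_boundary_inj.
by split; rewrite /= in_itv /= -ler_norml.
Qed.

Lemma pillow_to_boundary_continuous : continuous (@pillow_to_boundary R).
Proof.
by apply/quotient_continuous/quotient_continuous; exact: to_boundary_continuous.
Qed.

Lemma trace_boundary_hausdorff : hausdorff_space (trace_boundary R).
Proof.
move=> p q pq; apply: val_inj.
apply: norm_hausdorff => A B pA qB.
have cv := @initial_continuous (trace_boundary R) _ set_val.
have [r [rA rB]] := pq _ _ (cv p A pA) (cv q B qB).
by exists (set_val r).
Qed.

Lemma pillow_to_boundary_homeomorphism : homeomorphism (@pillow_to_boundary R).
Proof.
apply: compact_homeomorphism.
- exact: pillow_compact.
- exact: trace_boundary_hausdorff.
- exact: pillow_to_boundary_continuous.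
- exact: pillow_to_boundary_inj.
- move=> p; have [xi [_ _ <-]] := to_boundary_surj p.
  by exists (to_pillow (to_torus xi)).
Qed.

Lemma to_boundary_open V : open V -> open (@to_boundary R @` V).
Proof.
move=> oV; have [_ [g [cg fK gK]]] := pillow_to_boundary_homeomorphism.
rewrite (_ : _ @` _ = g @^-1` (@to_pillow R @` (@to_torus R @` V))).
  apply: open_comp; first by move=> p _; exact: cg.
  exact/to_pillow_open/to_torus_open.
apply/seteqP; split=> [_ [xi Vxi <-]|p /= [_ [xi Vxi <-] gp]].
  by exists (to_torus xi); [exists xi|rewrite fK].
by exists xi => //; rewrite -(gK p) -gp.
Qed.

Definition cat_map_inv xi : 'cV[R]_2 :=
  vec2 (xi 0 0 - xi 1 0) (2 * xi 1 0 - xi 0 0).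

Lemma cat_mapK : cancel (@cat_map R) cat_map_inv.
Proof.
by move=> xi; apply: cV2P; rewrite ?vec2_0 ?vec2_1 cat_map0 cat_map1; ring.
Qed.

Lemma cat_map_invK : cancel cat_map_inv (@cat_map R).
Proof.
by move=> xi; apply: cV2P; rewrite ?cat_map0 ?cat_map1 vec2_0 vec2_1; ring.
Qed.

Lemma boundary_map_continuous : continuous (@boundary_map R).
Proof.
have cv := @initial_continuous (trace_boundary R) _ set_val.
apply: continuous_comp_initial.
pose x (p : trace_boundary R) : R := (\val p).1.1.
pose y (p : trace_boundary R) : R := (\val p).1.2.
pose z (p : trace_boundary R) : R := (\val p).2.
have -> : set_val \o @boundary_map R = fun p : trace_boundary R =>
    (2 * x p * z p - y p, z p, 4 * x p * z p ^+ 2 - 2 * y p * z p - x p).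
  apply/funext => p; rewrite /x /y /z.
  rewrite [LHS](_ : _ = trace_map (\val p))//.
  by case: (\val p) => -[].
have cval (f : R * R * R -> R) : continuous f ->
    continuous (fun p : trace_boundary R => f (\val p)).
  by move=> cf p; exact: (continuous_comp (cv p) (cf (set_val p))).
have c1 : continuous (fst : R * R * R -> R * R) by move=> w; exact: cvg_fst.
have c11 : continuous (fst : R * R -> R) by move=> w; exact: cvg_fst.
have c12 : continuous (snd : R * R -> R) by move=> w; exact: cvg_snd.
have cx : continuous x.
  apply: (cval (fun w => w.1.1)) => w.
  exact: (continuous_comp (c1 w) (c11 (fst w))).
have cy : continuous y.
  apply: (cval (fun w => w.1.2)) => w.
  exact: (continuous_comp (c1 w) (c12 (fst w))).
have cz : continuous z by apply: (cval snd) => w; exact: cvg_snd.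
have cM (f g : trace_boundary R -> R) : continuous f -> continuous g ->
    continuous (fun p => f p * g p).
  by move=> cf cg p; exact: (@cvgM _ _ (nbhs p) _ _ _ _ _ (cf p) (cg p)).
have cB (f g : trace_boundary R -> R) : continuous f -> continuous g ->
    continuous (fun p => f p - g p).
  by move=> cf cg p; exact: (@cvgB _ _ _ (nbhs p) _ _ _ _ _ (cf p) (cg p)).
have cc (a : R) : continuous (fun _ : trace_boundary R => a).
  by move=> p; exact: cst_continuous.
have c2xz := cM _ _ (cM _ _ (cc 2) cx) cz.
have c2yz := cM _ _ (cM _ _ (cc 2) cy) cz.
have c4xzz := cM _ _ (cM _ _ (cc 4) cx) (cM _ _ cz cz).
have c3 := cB _ _ (cB _ _ c4xzz c2yz) cx.
move=> p; exact: (continuous_pair _ _ _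
  (continuous_pair _ _ _ (cB _ _ c2xz cy p) (cz p)) (c3 p)).
Qed.

(** The inverse matrix is also integral, so it carries the relation between two lifts of one point
    to a relation of the same kind. This gives injectivity, and compactness gives the continuity of
    the inverse. *)
Lemma boundary_map_homeomorphism : homeomorphism (@boundary_map R).
Proof.
apply: compact_homeomorphism.
- have [cf [g [cg fK gK]]] := pillow_to_boundary_homeomorphism.
  rewrite (_ : [set: _] = @pillow_to_boundary R @` setT).
    apply: continuous_compact; last exact: pillow_compact.
    exact: continuous_subspaceT.
  by apply/seteqP; split=> // p _; exists (g p).
- exact: trace_boundary_hausdorff.
- exact: boundary_map_continuous.
- move=> p q; have [xi [_ _ <-]] := to_boundary_surj p.
  have [eta [_ _ <-]] := to_boundary_surj q.
  rewrite !boundary_map_to_boundary => /to_boundary_eq[s [m E]].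
  apply/to_boundary_eq; exists s, (\col_i (if i == 0 then m 0 0 - m 1 0 else
    2 * m 1 0 - m 0 0)).
  have entry (a b : R) zeta (k : 'cV[int]_2) i :
      (a *: zeta + b *: map_mx intr k) i 0 = a * zeta i 0 + b * (k i 0)%:~R.
    by rewrite !mxE.
  rewrite -[LHS]cat_mapK E; apply: cV2P; rewrite ?vec2_0 ?vec2_1 !entry.
    by rewrite cat_map0 cat_map1 mxE /= intrB; ring.
  by rewrite cat_map0 cat_map1 mxE /= intrB intrM; ring.
- move=> p; have [xi [_ _ <-]] := to_boundary_surj p.
  exists (to_boundary (cat_map_inv xi)).
  by rewrite boundary_map_to_boundary cat_map_invK.
Qed.

End TorusTopology.

(** * Foliations *)

Section AffineNear.
Context {R : realType} {X Y : topologicalType}.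

Lemma affine_near_sym (u v : X -> R) p :
  affine_near 1 u v p -> affine_near 1 v u p.
Proof.
move=> [s [b uv]]; exists s, (- ((-1) ^+ s * b)).
apply: filterS uv => q ->.
by rewrite mulr1 mulrDr mulrA -signr_addb addbb mul1r addrK.
Qed.

Lemma affine_near_trans (k l : R) (u v w : X -> R) p :
  affine_near k u v p -> affine_near l v w p -> affine_near (l * k) u w p.
Proof.
move=> [s [b uv]] [t [c vw]]; exists (t (+) s), ((-1) ^+ t * l * b + c).
apply: filterS2 uv vw => q -> ->; rewrite signr_addb; ring.
Qed.

Lemma affine_near_comp (k : R) (f : Y -> X) (u v : X -> R) p :
  {for p, continuous f} -> affine_near k u v (f p) ->
  affine_near k (u \o f) (v \o f) p.
Proof. by move=> cf [s [b uv]]; exists s, b; exact: (cf _ uv). Qed.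

(** An open map sends neighbourhoods to neighbourhoods, so a local relation checked on one lift
    descends. *)
Lemma affine_near_push (k : R) (f : Y -> X) (u v : X -> R) p :
  (forall V, open V -> open (f @` V)) ->
  affine_near k (u \o f) (v \o f) p -> affine_near k u v (f p).
Proof.
move=> fo [s [b uv]]; exists s, b.
move/(open_image_nbhs f fo): uv; apply: filterS => _ [q h <-]; exact: h.
Qed.

End AffineNear.

(** On [W] the map [h] is open and injective, so the coordinates of [c] descend to its image; [f] is
    constrained only there. *)
Lemma push_chart {R : realType} {X Y : topologicalType} (c : chart (R := R) X)
    (h : X -> Y) (W : set X) (f : Y -> R * R) :
  is_chart c -> open W -> W `<=` c.1 ->
  continuous h -> (forall V, open V -> open (h @` V)) ->
  (forall x y, W x -> W y -> h x = h y -> x = y) ->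
  (forall x, W x -> f (h x) = c.2 x) ->
  is_chart (h @` W, f).
Proof.
move=> [_ cc ci co] oW Wc ch ho hi fc; split=> /=.
- exact: ho.
- move=> _ [x Wx <-] A; rewrite fc// => /(cc x (Wc x Wx)) nA.
  have : nbhs x (W `&` c.2 @^-1` A).
    by apply: filterI => //; exact: open_nbhs_nbhs.
  move=> /(open_image_nbhs h ho); apply: filterS => _ [z [Wz Az] <-].
  by rewrite /= fc.
- move=> _ _ [x Wx <-] [y Wy <-]; rewrite !fc// => /ci -> //; exact: Wc.
- move=> V oV VhW; rewrite (_ : f @` V = c.2 @` (W `&` h @^-1` V)).
    apply: co => [|x [/Wc]//]; apply: openI => //.
    by apply: open_comp oV => x _; exact: ch.
  apply/seteqP; split=> [_ [y Vy <-]|_ [x [Wx Vhx] <-]].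
    have [x Wx xy] := VhW y Vy; exists x; last by rewrite -fc// xy.
    by split=> //=; rewrite xy.
  by exists (h x) => //; exact: fc.
Qed.

Section PlaneFoliation.
Context {R : realType}.
Implicit Types (v w xi eta : 'cV[R]_2).

Definition det_form v xi : R := \det (row_mx v xi : 'M[R]_2).

Lemma det_formE v xi : det_form v xi = v 0 0 * xi 1 0 - xi 0 0 * v 1 0.
Proof.
rewrite /det_form det_mx22.
have e0 i : (row_mx v xi : 'M[R]_2) i 0 = v i 0.
  by rewrite -(row_mxEl v xi); congr (row_mx _ _ _ _); exact: val_inj.
have e1 i : (row_mx v xi : 'M[R]_2) i 1 = xi i 0.
  by rewrite -(row_mxEr v xi); congr (row_mx _ _ _ _); exact: val_inj.
by rewrite !e0 !e1.
Qed.

Lemma det_formD v xi eta : det_form v (xi + eta) = det_form v xi + det_form v eta.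
Proof. by rewrite !det_formE !mxE; ring. Qed.

Lemma det_formZ v (a : R) xi : det_form v (a *: xi) = a * det_form v xi.
Proof. by rewrite !det_formE !mxE; ring. Qed.

(** The determinant is the squared Euclidean length of [v]. The rotated vector provides the
    coordinate along the leaves. *)
Lemma det_form_rot_neq0 v : v != 0 -> det_form v (vec2 (- v 1 0) (v 0 0)) != 0.
Proof.
rewrite det_formE vec2_0 vec2_1 mulNr opprK; apply: contra; rewrite -!expr2 paddr_eq0 ?sqr_ge0// !sqrf_eq0 => /andP[/eqP e0 /eqP e1].
by apply/eqP/cV2P; rewrite mxE.
Qed.

Lemma plane_chart v w (a b c d : R) : a != 0 -> c != 0 -> det_form v w != 0 ->
  is_chart ([set: 'cV[R]_2],
    fun xi => (a * det_form w xi + b, c * det_form v xi + d)).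
Proof.
move=> a0 c0 vw0; set f := fun xi => _.
have cform u : continuous (det_form u).
  rewrite (_ : det_form u = fun xi => u 0 0 * xi 1 0 - xi 0 0 * u 1 0).
    move=> xi; apply: (@cvgB _ _ _ (nbhs xi) _ _ _).
      exact: (@cvgM _ _ (nbhs xi) _ _ _ _ _ (@cvg_cst _ _ _ (nbhs xi) _)
        (coord1_continuous xi)).
    exact: (@cvgM _ _ (nbhs xi) _ _ _ _ _ (coord0_continuous xi)
      (@cvg_cst _ _ _ (nbhs xi) _)).
  by apply/funext => xi; exact: det_formE.
have caff u (s t : R) : continuous (fun xi => s * det_form u xi + t).
  move=> xi; apply: (@cvgD _ _ _ (nbhs xi)); last exact: cvg_cst.
  exact: (@cvgM _ _ (nbhs xi) _ _ _ _ _ (@cvg_cst _ _ _ (nbhs xi) _) (cform u xi)).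
have cf : continuous f.
  by move=> xi; exact: (continuous_pair _ _ _ (caff w a b xi) (caff v c d xi)).
(* Cramer's rule: det (v, w) xi = det (v, xi) w - det (w, xi) v. *)
pose g (z : R * R) : 'cV[R]_2 := (det_form v w)^-1 *:
  (((z.2 - d) / c) *: w - ((z.1 - b) / a) *: v).
have fK : cancel f g.
  have e (x y z : R) : x != 0 -> (x * y + z - z) / x = y.
    by move=> x0; rewrite addrK mulrC mulKf.
  move=> xi; rewrite /g /f /= !e//.
  apply: cV2P; rewrite !mxE; apply: (mulfI vw0); rewrite mulVKf//;
    by rewrite !det_formE; ring.
have gK : cancel g f.
  move=> [x y]; rewrite /f /g /= !det_formZ.
  rewrite -[- (_ *: v)]scaleN1r !det_formD !det_formZ.
  have -> : det_form w w = 0 by rewrite det_formE; ring.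
  have -> : det_form v v = 0 by rewrite det_formE; ring.
  have -> : det_form w v = - det_form v w by rewrite !det_formE; ring.
  by congr (_, _); field; rewrite ?vw0 ?a0 ?c0.
split=> /=.
- exact: openT.
- by move=> p _; exact: cf.
- by move=> p q _ _ /(can_inj fK).
move=> V oV _; rewrite (_ : f @` V = g @^-1` V); last first.
  apply/seteqP; split=> [_ [xi Vxi <-]|z Vz]; first by rewrite /= fK.
  by exists (g z).
apply: open_comp oV => z _ A /nbhs_cV2P[e e0 eA].
have cg i : continuous (fun z : R * R => g z i 0).
  rewrite /g (_ : (fun z : R * R => _) = fun z : R * R =>
    (det_form v w)^-1 * w i 0 / c * z.2 + - ((det_form v w)^-1 * v i 0 / a) * z.1
      + (det_form v w)^-1 * (b / a * v i 0 - d / c * w i 0)).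
    move=> z'; apply: (@cvgD _ _ _ (nbhs z')); last exact: cvg_cst.
    apply: (@cvgD _ _ _ (nbhs z')).
      exact: (@cvgM _ _ (nbhs z') _ _ _ _ _ (@cvg_cst _ _ _ (nbhs z') _) cvg_snd).
    exact: (@cvgM _ _ (nbhs z') _ _ _ _ _ (@cvg_cst _ _ _ (nbhs z') _) cvg_fst).
  apply/funext => z'; rewrite !mxE; ring.
have near i : nbhs z [set z' | `|g z i 0 - g z' i 0| < e].
  exact: (cg i z _ (nbhsx_ballx (g z i 0) e e0)).
by apply: filterS2 (near 0) (near 1) => z' /= h0 h1; exact: eA.
Qed.

End PlaneFoliation.

(** * Foliations read through a flat projection of the plane *)

Section AdaptedCharts.
Context {R : realType} {Y : topologicalType}.
Implicit Types (v w xi eta : 'cV[R]_2) (d : chart (R := R) Y).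

(* The deck condition says that h is locally the quotient by a group of
   isometries of the form zeta |-> +- zeta + t. *)
Definition flat_projection (h : 'cV[R]_2 -> Y) : Prop :=
  [/\ continuous h, (forall V, open V -> open (h @` V)),
      (forall y, exists xi, h xi = y) &
      forall xi eta, h xi = h eta -> exists (s : bool) t,
        (-1) ^+ s *: xi + t = eta /\
        forall zeta, h ((-1) ^+ s *: zeta + t) = h zeta].

Definition unramified_over (h : 'cV[R]_2 -> Y) (S : set Y) : Prop :=
  forall xi, S (h xi) -> exists W : set 'cV[R]_2,
    [/\ open W, W xi, h @` W `<=` S &
        forall eta zeta, W eta -> W zeta -> h eta = h zeta -> eta = zeta].

(** A condition on lifts to the plane alone, to which the iterated quotients defining
    [torus_foliation] and [boundary_foliation] both reduce. *)
Definition adapted_chart (h : 'cV[R]_2 -> Y) v d : Prop :=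
  is_chart d /\ forall xi, d.1 (h xi) ->
    affine_near 1 (det_form v) (transverse_coord d \o h) xi.

Variables (h : 'cV[R]_2 -> Y) (S : set Y).
Hypotheses (hf : flat_projection h) (hS : unramified_over h S).

(** The chart is a local inverse of [h] on [W] followed by linear coordinates. Compatibility is
    required at every lift: a deck transformation brings it into [W] and changes [det_form v] by a
    sign and a constant. *)
Lemma adapted_chart_exists v y : v != 0 -> S y ->
  exists d, [/\ adapted_chart h v d, d.1 `<=` S & d.1 y].
Proof.
move=> v0 Sy; have [ch ho hs deck] := hf.
have [xi xiy] := hs y; rewrite -xiy in Sy *.
have [W [oW Wxi WS hi]] := hS xi Sy.
pose w := vec2 (- v 1 0) (v 0 0).
have vw : det_form v w != 0 by exact: det_form_rot_neq0.
have cc := plane_chart v w 1 0 1 0 (oner_neq0 _) (oner_neq0 _) vw.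
(* The default 0 is taken only outside the image of [W], which is the domain of the chart. *)
pose g y := xget 0 [set x | W x /\ h x = y].
have gK x : W x -> g (h x) = x.
  move=> Wx; have [Wg hg] : [set z | W z /\ h z = h x] (g (h x)).
    by apply: (@xgetPex _ 0 [set z | W z /\ h z = h x]); exists x.
  exact: hi.
pose f y := (1 * det_form w (g y) + 0, 1 * det_form v (g y) + 0).
have fc x : W x -> f (h x) = (1 * det_form w x + 0, 1 * det_form v x + 0).
  by move=> Wx; rewrite /f gK.
exists (h @` W, f); split=> //=; last by exists xi.
split; first exact: push_chart cc oW (@subsetT _ _) ch ho hi fc.
move=> eta [zeta Wzeta /esym/deck[s [t [etaE hst]]]].
exists s, (det_form v t).
have : \forall q \near eta, W ((-1) ^+ s *: q + t).
  by apply: (affine_continuous _ t eta); rewrite etaE; exact: open_nbhs_nbhs.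
apply: filterS => q Wq; rewrite [LHS](_ : _ = (f (h q)).2)//.
by rewrite -(hst q) fc//= det_formD det_formZ mul1r addr0 mulr1.
Qed.

Lemma measured_foliation_adapted v (F : set (chart (R := R) Y)) : v != 0 ->
  (forall d, F d <-> adapted_chart h v d /\ d.1 `<=` S) ->
  measured_foliation S F.
Proof.
move=> v0 FE; have [ch ho hs deck] := hf; split.
- by move=> c /FE[[cc _] cS].
- move=> p /(adapted_chart_exists v p v0)[d [ad dS dp]].
  by exists d => //; apply/FE.
- move=> c d p /FE[[_ ac] _] /FE[[_ ad] _] cp dp.
  have [xi xip] := hs p; rewrite -xip in cp dp *.
  apply: affine_near_push => //; rewrite -[1]mul1r.
  by apply: affine_near_trans (ad _ dp); apply: affine_near_sym; exact: ac.
Qed.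

(** Near a lift the two transverse coordinates are affine in [det_form v] and [det_form w], which
    together are coordinates of the plane; this chart is pushed down by [h]. *)
Lemma transverse_adapted v w (F G : set (chart (R := R) Y)) :
  det_form v w != 0 ->
  (forall d, F d -> adapted_chart h v d /\ d.1 `<=` S) ->
  (forall d, G d -> adapted_chart h w d) ->
  transverse F G.
Proof.
move=> vw FE GE c d p /FE[[_ ac] cS] /GE[_ ad] cp dp.
have [ch ho hs deck] := hf.
have [xi xip] := hs p; rewrite -xip in cp dp *.
have [W [oW Wxi WS hi]] := hS xi (cS _ cp).
have [s [b cE]] := ac xi cp; have [t [b' dE]] := ad xi dp.
have : nbhs xi (W `&` [set q |
    transverse_coord c (h q) = (-1) ^+ s * 1 * det_form v q + b /\
    transverse_coord d (h q) = (-1) ^+ t * 1 * det_form w q + b']).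
  apply: filterI; first exact: open_nbhs_nbhs.
  by apply: filterS2 cE dE => q.
rewrite nbhsE => -[U [oU Uxi] UW].
have wv : det_form w v != 0.
  by rewrite (_ : det_form w v = - det_form v w) ?oppr_eq0// !det_formE; ring.
have cc := plane_chart w v ((-1) ^+ s * 1) b ((-1) ^+ t * 1) b'.
rewrite !mulr1 !signr_eq0 in cc.
exists (h @` U); first by exists xi.
apply: (push_chart _ h U _ (cc isT isT wv)) => //.
  by move=> x y /UW[Wx _] /UW[Wy _]; exact: hi.
by move=> x /UW[_ /= [-> ->]]; rewrite !mulr1.
Qed.

(** Upstairs [T] becomes [A], which multiplies the form [det_form v] by [k]; the relation then
    descends along the open map [h]. *)
Lemma multiplies_measure_adapted v (k : R) (T : Y -> Y)
    (A : 'cV[R]_2 -> 'cV[R]_2) (F : set (chart (R := R) Y)) :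
  continuous A -> (forall xi, T (h xi) = h (A xi)) ->
  (forall xi, det_form v (A xi) = k * det_form v xi) ->
  (forall d, F d -> adapted_chart h v d) ->
  multiplies_measure T k F.
Proof.
move=> cA TA kA FE c d p /FE[_ ac] /FE[_ ad] cp dp.
have [ch ho hs deck] := hf.
have [xi xip] := hs p; rewrite -xip TA in dp; rewrite -xip in cp *.
apply: affine_near_push => //; rewrite -[k]mulr1.
apply: affine_near_trans (affine_near_sym _ _ _ (ac _ cp)) _.
have [s [b hb]] := affine_near_comp 1 A _ _ xi (cA xi) (ad _ dp).
exists s, b; apply: filterS hb => q /= hq.
by rewrite TA hq kA mulr1 mulrA.
Qed.

End AdaptedCharts.

Lemma flat_projection_torus {R : realType} : flat_projection (@to_torus R).
Proof.
split; [exact: to_torus_continuous|exact: to_torus_open| |].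
  by move=> p; exists (torus_repr p); exact: torus_reprK.
move=> xi eta /esym/to_torus_eq[m mE].
exists false, ((2 * trigo.pi) *: map_mx intr m).
rewrite expr0 scale1r -mE; split; first by rewrite addrC subrK.
move=> zeta; apply/to_torus_eq; exists m.
by rewrite scale1r mE addrAC subrr add0r.
Qed.

Lemma flat_projection_boundary {R : realType} : flat_projection (@to_boundary R).
Proof.
split; [exact: to_boundary_continuous|exact: to_boundary_open| |].
  by move=> p; have [xi [_ _ <-]] := to_boundary_surj p; exists xi.
move=> xi eta /to_boundary_eq[s [m ->]].
exists s, ((2 * trigo.pi) *: map_mx intr m); split=> // zeta.
by apply/esym/to_boundary_eq; exists s, m.
Qed.

(** * Injectivity of the projections near unbranched points *)

Section Unramified.
Context {R : realType}.
Local Notation pi := (@trigo.pi R).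
Implicit Types (v w xi eta : 'cV[R]_2).

Lemma sin_intpi (k : int) : sin (pi * k%:~R) = 0.
Proof.
have := sinB_intpi (0 : R) (- k).
by rewrite sub0r mulrNz mulrN opprK sin0 normr0 => /normr0_eq0.
Qed.

(** In a box of half side 1 coordinates differ by less than 2, while nonzero multiples of [2 * pi]
    are at least 4 in absolute value. *)
Lemma unramified_torus : unramified_over (@to_torus R) setT.
Proof.
move=> xi _.
have : nbhs xi [set eta | `|xi 0 0 - eta 0 0| < 1 /\ `|xi 1 0 - eta 1 0| < 1].
  by apply/nbhs_cV2P; exists 1.
rewrite nbhsE => -[W [oW Wxi] W1]; exists W; split=> //.
move=> eta zeta /W1[] + + /W1[]; rewrite !ltr_norml.
move=> /andP[e1 e2] /andP[e3 e4] /andP[z1 z2] /andP[z3 z4] /to_torus_eq[m mE].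
have pi2 := pi_ge2 R.
have small (p x y : R) (k : int) : 2 <= p -> x - y = 2 * p * k%:~R ->
    -2 < x - y < 2 -> x = y.
  move=> p2 xyE /andP[l1 l2].
  suff k0 : k = 0 by apply/eqP; rewrite -subr_eq0 xyE k0 mulr0.
  have [k0|k0|//] := ltgtP k 0; exfalso.
    have : k%:~R <= -1 :> R by rewrite -[-1]/((-1)%:~R) ler_int -ltzD1.
    move=> k1; have : p * k%:~R <= p * -1 by apply: ler_wpM2l => //; lra.
    lra.
  have : 1 <= k%:~R :> R by rewrite -[1]/(1%:~R) ler_int -gtz0_ge1.
  move=> k1; have : p * 1 <= p * k%:~R by apply: ler_wpM2l => //; lra.
  lra.
have E i : eta i 0 - zeta i 0 = 2 * pi * (m i 0)%:~R.
  by have /matrixP/(_ i 0) := mE; rewrite !mxE.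
apply: cV2P; apply: small pi2 (E _) _; apply/andP; split; lra.
Qed.

Lemma orbifold_pointsE xi : orbifold_points (to_boundary xi) <->
  sin (xi 0 0) = 0 /\ sin (xi 1 0) = 0.
Proof.
split=> [[q qfix]|[/sin_eq0_intpi[k kE] /sin_eq0_intpi[l lE]]].
  have [eta etaq] : exists eta, to_torus eta = q.
    by exists (torus_repr q); exact: torus_reprK.
  move: qfix; rewrite -etaq /= torus_oppE => /esym/to_torus_eq[n nE].
  rewrite -/(to_boundary _) => /to_boundary_eq[s [m ->]].
  have E i : eta i 0 = pi * (n i 0)%:~R.
    have /matrixP/(_ i 0) := nE; rewrite !mxE => e.
    by apply: (@mulfI _ 2) => //; rewrite mulrA -e; ring.
  have H i : sin (((-1) ^+ s *: eta + (2 * pi) *: map_mx intr m) i 0) = 0.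
    rewrite !mxE E (_ : _ + _ = pi * ((-1) ^+ s * n i 0 + 2 * m i 0)%:~R).
      exact: sin_intpi.
    rewrite intrD !intrM; case: (s); rewrite ?expr1 ?expr0 ?mulrN1z; ring.
  by split; exact: H.
exists (to_torus xi) => //=; rewrite torus_oppE; apply/to_torus_eq.
exists (\col_i (if i == 0 then - k else - l)).
by apply: cV2P; rewrite !mxE /= ?kE ?lE mulrNz; ring.
Qed.

(** Some coordinate of the lift has nonzero sine, and still does on a small box. Two points of the
    box related with sign -1 would have a midpoint, again within the bounds on that coordinate,
    where it lies in pi Z. Only translations remain, and [unramified_torus] excludes the nonzero
    ones. *)
Lemma unramified_boundary :
  unramified_over (@to_boundary R) (~` orbifold_points).
Proof.
move=> xi nP.
have H (i : 'I_2) : sin (xi i 0) <> 0 -> exists W : set 'cV[R]_2,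
    [/\ open W, W xi, @to_boundary R @` W `<=` ~` orbifold_points &
    forall eta zeta, W eta -> W zeta -> to_boundary eta = to_boundary zeta ->
      eta = zeta].
  move=> xi0.
  have [W1 [oW1 W1xi _ W1i]] := unramified_torus xi I.
  have : nbhs (xi i 0) [set x | sin x != 0].
    have sn : nbhs (sin (xi i 0)) [set y | y != 0].
      by apply: open_nbhs_nbhs; split; [exact: open_neq|exact/eqP].
    exact: (@continuous_sin R (xi i 0) _ sn).
  move=> /nbhs_ballP[e /= e0 eS].
  have : nbhs xi (W1 `&` [set eta | `|xi i 0 - eta i 0| < e]).
    apply: filterI; first exact: open_nbhs_nbhs.
    apply/nbhs_cV2P; exists e => // eta h0 h1 /=.
    by have [->|->] := ord2P i.
  rewrite nbhsE => -[W [oW Wxi] WW]; exists W; split=> //.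
    move=> _ [eta /WW[_ /= We] <-] /orbifold_pointsE[s0 s1].
    have /eqP := eS _ We; apply.
    by have [->|->] := ord2P i.
  move=> eta zeta Weta Wzeta /to_boundary_eq[s [m mE]].
  have [W1eta /= Weta'] := WW _ Weta; have [W1zeta /= Wzeta'] := WW _ Wzeta.
  case: s mE => mE.
    exfalso; have : sin ((eta i 0 + zeta i 0) / 2) != 0.
      apply: eS; move: Weta' Wzeta'; rewrite /ball /= !ltr_norml.
      by move=> /andP[a1 a2] /andP[b1 b2]; apply/andP; split; lra.
    rewrite mE !mxE expr1.
    rewrite (_ : _ / 2 = pi * (m i 0)%:~R) ?sin_intpi ?eqxx//.
    by move: pi (xi) => p _; field.
  apply: W1i => //; apply/to_torus_eq; exists (- m).
  by rewrite mE expr0 scale1r opprD addNKr map_mxN scalerN.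
have [s0|/eqP s0] := eqVneq (sin (xi 0 0)) 0; last exact: H s0.
have [s1|/eqP s1] := eqVneq (sin (xi 1 0)) 0; last exact: H s1.
by case: nP; apply/orbifold_pointsE.
Qed.

End Unramified.

(** * The foliations of the torus and of the boundary *)

Section QuotientFoliations.
Context {R : realType}.
Local Notation lambda := (@cat_eigenvalue R).
Implicit Types (v w xi eta : 'cV[R]_2).

Lemma plane_foliation_exists v : v != 0 ->
  exists2 c, plane_foliation v c & c.1 = setT.
Proof.
move=> v0; have cc := plane_chart v _ 1 0 1 0 (oner_neq0 _) (oner_neq0 _)
  (det_form_rot_neq0 v v0).
exists ([set: 'cV[R]_2], fun xi =>
  (1 * det_form (vec2 (- v 1 0) (v 0 0)) xi + 0, 1 * det_form v xi + 0)) => //.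
split=> // p _; exists false, 0.
by apply: (@filterE _ (nbhs p)) => q; rewrite expr0 mulr1.
Qed.

(** Testing against one global linear chart of the plane suffices, because every chart of
    [plane_foliation v] is locally affine in [det_form v]. *)
Lemma torus_foliationE v (d : chart (R := R) (torus R)) : v != 0 ->
  torus_foliation v d <-> adapted_chart (@to_torus R) v d /\ d.1 `<=` setT.
Proof.
move=> v0; split=> [[cd _ fd]|[[cd ad] _]].
  have [c cv cT] := plane_foliation_exists v v0; split=> //; split=> // xi dxi.
  have [_ cE] := cv.
  have cxi : c.1 xi by rewrite cT.
  by rewrite -[1]mulr1; apply: affine_near_trans (cE _ cxi) (fd _ _ cv cxi dxi).
split=> // c p [_ cE] cp dp; rewrite -[1]mulr1.
by apply: affine_near_trans (affine_near_sym _ _ _ (cE _ cp)) (ad _ dp).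
Qed.

(** Adapted charts of the torus exist around every point, and composing with one of them turns
    compatibility over the torus into compatibility over the plane. *)
Lemma boundary_foliationE v (d : chart (R := R) (trace_boundary R)) : v != 0 ->
  boundary_foliation v d <->
  adapted_chart (@to_boundary R) v d /\ d.1 `<=` ~` orbifold_points.
Proof.
move=> v0; have [tc to ts _] := @flat_projection_torus R.
split=> [[cd dP fd]|[[cd ad] dP]].
  split=> //; split=> // xi dxi.
  have [c [[cc ac] _ cxi]] := adapted_chart_exists _ _ flat_projection_torus
    unramified_torus v (to_torus xi) v0 I.
  have cF : torus_foliation v c by apply/torus_foliationE.
  rewrite -[1]mulr1; apply: affine_near_trans (ac _ cxi) _.
  exact: (affine_near_comp _ (@to_torus R) _ _ _ (tc xi) (fd _ _ cF cxi dxi)).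
split=> // c p /(torus_foliationE _ _ v0)[[cc ac] _] cp dp.
have [xi xip] := ts p; rewrite -xip in cp dp *.
apply: affine_near_push => //; rewrite -[1]mulr1.
by apply: affine_near_trans (affine_near_sym _ _ _ (ac _ cp)) (ad _ dp).
Qed.

Lemma boundary_map_orbifold :
  @boundary_map R @` orbifold_points = orbifold_points.
Proof.
apply/seteqP; split=> [_ [p + <-]|p].
  have [xi [_ _ <-]] := to_boundary_surj p; rewrite boundary_map_to_boundary.
  move=> /orbifold_pointsE[s0 s1]; apply/orbifold_pointsE.
  rewrite cat_map0 cat_map1 mulrDl mul1r !sinD s0 s1.
  by split; ring.
have [xi [_ _ <-]] := to_boundary_surj p => /orbifold_pointsE[s0 s1].
exists (to_boundary (cat_map_inv xi)); last first.
  by rewrite boundary_map_to_boundary cat_map_invK.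
apply/orbifold_pointsE; rewrite vec2_0 vec2_1 mulrDl mul1r !sinB sinD s0 s1.
by split; ring.
Qed.

Lemma eigenvector_coord (a : R) v : cat_map v = a *: v ->
  2 * v 0 0 + v 1 0 = a * v 0 0 /\ v 0 0 + v 1 0 = a * v 1 0.
Proof. by move=> E; rewrite -cat_map0 -cat_map1 E !mxE. Qed.

(* Since [det A = 1], [a det (v, A xi) = det (A v, A xi) = det (v, xi)]. *)
Lemma det_form_cat_map (a : R) v xi : a != 0 -> cat_map v = a *: v ->
  det_form v (cat_map xi) = a^-1 * det_form v xi.
Proof.
move=> a0 /eigenvector_coord[e0 e1].
apply: (mulfI a0); rewrite mulVKf// !det_formE cat_map0 cat_map1.
rewrite mulrBr !mulrA -e0 [a * _ * v 1 0]mulrAC -e1; ring.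
Qed.

(** The second row of the eigenvector equation gives [v 0 0 = (a - 1) * v 1 0], so the second
    coordinates are nonzero and the determinant is [a - b] times their product. *)
Lemma eigenvectors_independent (a b : R) v w : a != b -> v != 0 -> w != 0 ->
  cat_map v = a *: v -> cat_map w = b *: w -> det_form v w != 0.
Proof.
move=> ab v0 w0 /eigenvector_coord[v1 v2] /eigenvector_coord[w1 w2].
have v10 : v 1 0 != 0.
  apply: contra v0 => /eqP E; rewrite E in v1 v2; apply/eqP.
  by apply: cV2P; rewrite mxE//; lra.
have w10 : w 1 0 != 0.
  apply: contra w0 => /eqP E; rewrite E in w1 w2; apply/eqP.
  by apply: cV2P; rewrite mxE//; lra.
rewrite (_ : det_form v w = (a - b) * (v 1 0 * w 1 0)).
  by rewrite !mulf_neq0 ?subr_eq0.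
rewrite det_formE mulrBl !mulrA -v2 [b * _ * _]mulrAC -w2; ring.
Qed.

Lemma eigenvector_exists (a : R) : a ^+ 2 = 3 * a - 1 ->
  exists v : 'cV[R]_2, is_eigenvector a v.
Proof.
move=> a2; exists (vec2 (a - 1) 1); split; last exact: cat_eigenvector_vec2.
by apply/eqP => /matrixP/(_ 1 0); rewrite vec2_1 mxE; exact/eqP/oner_neq0.
Qed.

Lemma cat_eigenvalueV_sqr : lambda^-1 ^+ 2 = 3 * lambda^-1 - 1.
Proof. by rewrite cat_eigenvalueV sqrrB cat_eigenvalue_sqr; ring. Qed.

(** The form [det_form vs] vanishes along the contracted direction and is multiplied by the inverse
    of its eigenvalue, that is by [lambda]; for [vu] the factor is [lambda^-1]. *)
Lemma boundary_map_pseudo_Anosov vs vu :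
  is_eigenvector lambda^-1 vs -> is_eigenvector lambda vu ->
  orbifold_pseudo_Anosov orbifold_points (@boundary_map R) lambda
    (boundary_foliation vs) (boundary_foliation vu).
Proof.
move=> [vs0 vsE] [vu0 vuE].
have l2 := @cat_eigenvalue_gt2 R; have l3 := @cat_eigenvalue_lt3 R.
have l0 : lambda != 0 by rewrite gt_eqF// cat_eigenvalue_gt0.
have cA : continuous (@cat_map R).
  move=> xi A /nbhs_cV2P[e e0 eA]; apply/nbhs_cV2P; exists (e / 3).
    by rewrite divr_gt0.
  move=> eta; rewrite !ltr_norml => /andP[h1 h2] /andP[h3 h4].
  by apply: eA; rewrite ?cat_map0 ?cat_map1 ltr_norml; apply/andP; split; lra.
have bs d := boundary_foliationE vs d vs0.
have bu d := boundary_foliationE vu d vu0.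
split.
- by split; [exact: boundary_map_homeomorphism|exact: boundary_map_orbifold].
- by lra.
- split.
    exact: (measured_foliation_adapted _ _ flat_projection_boundary
      unramified_boundary vs).
  exact: (measured_foliation_adapted _ _ flat_projection_boundary
    unramified_boundary vu).
- apply: (transverse_adapted _ _ flat_projection_boundary unramified_boundary
    vs vu).
  + apply: (eigenvectors_independent lambda^-1 lambda) => //.
    by rewrite cat_eigenvalueV; apply/eqP; lra.
  + by move=> d /bs.
  + by move=> d /bu[].
- split.
    apply: (multiplies_measure_adapted _ flat_projection_boundary vs _ _
      (@cat_map R)) => // [xi|xi|d /bs[]//].
      exact: boundary_map_to_boundary.
    by rewrite (det_form_cat_map lambda^-1) ?invr_neq0// invrK.
  apply: (multiplies_measure_adapted _ flat_projection_boundary vu _ _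
    (@cat_map R)) => // [xi|xi|d /bu[]//].
    exact: boundary_map_to_boundary.
  exact: det_form_cat_map.
Qed.

End QuotientFoliations.

Theorem theorem10p2 (R : realType) :
  let T : trace_boundary R -> trace_boundary R := boundary_map in
  let lambda : R := (3 + Num.sqrt 5) / 2 in
  [/\ [/\ homeomorphism (@pillow_to_boundary R),
          forall xi : 'cV[R]_2,
            \val (pillow_to_boundary (to_pillow (to_torus xi))) =
            (cos (xi 0 0), cos (xi 1 0), cos (xi 0 0 + xi 1 0)) &
          forall P : pillowcase R,
            T (pillow_to_boundary P) = pillow_to_boundary (pillow_cat P)],
      topological_entropy T = (ln lambda)%:E,
      dense (periodic_points T) &
      [/\ exists v : 'cV[R]_2, is_eigenvector lambda^-1 v,
          exists v : 'cV[R]_2, is_eigenvector lambda v &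
          forall vs vu : 'cV[R]_2,
            is_eigenvector lambda^-1 vs -> is_eigenvector lambda vu ->
            [/\ measured_foliation setT (torus_foliation vs),
                measured_foliation setT (torus_foliation vu) &
                orbifold_pseudo_Anosov orbifold_points T lambda
                  (boundary_foliation vs) (boundary_foliation vu)]]].
Proof.
split.
- split; [exact: pillow_to_boundary_homeomorphism|exact: pillow_to_boundaryE|].
  move=> P; rewrite -(pillow_reprK P) -(torus_reprK (pillow_repr P)).
  by rewrite pillow_catE torus_catE; exact: boundary_map_to_boundary.
- exact: topological_entropy_boundary_map.
- exact: dense_periodic_points.
- split.
  + exact: (eigenvector_exists _ cat_eigenvalueV_sqr).
  + exact: (eigenvector_exists _ cat_eigenvalue_sqr).
  + move=> vs vu evs evu; split; last exact: boundary_map_pseudo_Anosov.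
    * apply: (measured_foliation_adapted _ _ flat_projection_torus
        unramified_torus vs) => [|d]; first exact: evs.1.
      by apply: torus_foliationE; exact: evs.1.
    * apply: (measured_foliation_adapted _ _ flat_projection_torus
        unramified_torus vu) => [|d]; first exact: evu.1.
      by apply: torus_foliationE; exact: evu.1.
Qed.
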